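(* Let $\mathcal F$ be any collection of spaces and let $X\xrightarrow{j}Y\xrightarrow{q}Z$ be a cofiber sequence. Then $\mathrm{kl}_{\mathcal F}(Y)\le \mathrm{kl}_{\mathcal F}(X)+\mathrm{kl}_{\mathcal F}(Z)$.
   Context: All spaces are based, connected and have the based homotopy type of CW complexes; maps and homotopies preserve base points; $\equiv$ means same homotopy type. An $\mathcal F$-killing length decomposition of $X$ of length $m$ is a sequence of cofiber sequences $L_i\to X_i\to X_{i+1}$, $0\le i<m$, with each $L_i$ a wedge of spaces belonging to $\mathcal F$, $X_0\equiv X$ and $X_m\equiv *$. The $\mathcal F$-killing length $\mathrm{kl}_{\mathcal F}(X)$ is $0$ if $X\equiv *$, and otherwise the smallest $m$ for which an $\mathcal F$-killing length decomposition of $X$ of length $m$ exists ($\infty$ if none exists). *)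

(* Defs.v *)
(* Based spaces are [ptopologicalType]s, with base point [point]. *)
From HB Require Import structures.
From mathcomp Require Import all_boot all_order all_algebra generic_quotient.
From mathcomp Require Import all_classical all_reals all_analysis homotopy.

Set Implicit Arguments.
Unset Strict Implicit.
Unset Printing Implicit Defensive.

Import Order.TTheory GRing.Theory Num.Theory.
Import numFieldNormedType.Exports.

Local Open Scope classical_set_scope.
Local Open Scope ring_scope.
Local Open Scope quotient_scope.

Definition unit_interval (R : realType) : topologicalType :=
  set_type `[(0 : R), 1]%classic.

Fact mem_itv0 (R : realType) : (0 : R) \in `[(0 : R), 1]%classic.
Proof. by rewrite inE /= in_itv /= lexx ler01. Qed.

Fact mem_itv1 (R : realType) : (1 : R) \in `[(0 : R), 1]%classic.
Proof. by rewrite inE /= in_itv /= lexx ler01. Qed.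

Definition itv0 (R : realType) : unit_interval R := exist _ 0 (mem_itv0 R).
Definition itv1 (R : realType) : unit_interval R := exist _ 1 (mem_itv1 R).

Definition based_map (X Y : ptopologicalType) (f : X -> Y) : Prop :=
  continuous f /\ f point = point.

Definition based_homotopic (R : realType) (X Y : ptopologicalType)
    (f g : X -> Y) : Prop :=
  exists H : X * unit_interval R -> Y,
    [/\ continuous H,
        (forall x, H (x, itv0 R) = f x),
        (forall x, H (x, itv1 R) = g x) &
        (forall t, H (point, t) = point)].

Definition based_heq (R : realType) (X Y : ptopologicalType)
    (f : X -> Y) : Prop :=
  based_map f /\
  exists g : Y -> X, [/\ based_map g,
    based_homotopic R (g \o f) id & based_homotopic R (f \o g) id].

Definition same_htype (R : realType) (X Y : ptopologicalType) : Prop :=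
  exists f : X -> Y, based_heq R f.

Definition one_point : Type := discrete_topology unit.
HB.instance Definition _ := Topological.on one_point.
HB.instance Definition _ := Pointed.on one_point.

(* Cells are modelled on the cube [-1,1]^n instead of the round n-disc, to which
   it is homeomorphic, boundary to boundary.  For n = 0 both sets below are the
   whole one-point space 'rV_0. *)
Definition cube (R : realType) (n : nat) : set 'rV[R]_n :=
  [set v | forall i, `|v ord0 i| <= 1].

Definition open_cube (R : realType) (n : nat) : set 'rV[R]_n :=
  [set v | forall i, `|v ord0 i| < 1].

Arguments cube : clear implicits.
Arguments open_cube : clear implicits.

(* J. H. C. Whitehead's definition: [C n] indexes the n-cells and [phi n c] is the
   characteristic map of the cell [c]; only its values on the cube matter. *)
Definition cw_structure (R : realType) (K : topologicalType)
    (C : nat -> Type) (phi : forall n, C n -> 'rV[R]_n -> K) : Prop :=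
  let open_cell (e : {n & C n}) : set K :=
    phi (projT1 e) (projT2 e) @` open_cube R (projT1 e) in
  [/\ hausdorff_space K,
      (forall n (c : C n), {within cube R n, continuous (phi n c)} /\
         {in open_cube R n &, injective (phi n c)}),
      (forall y : K, exists! e, open_cell e y),
      (forall n (c : C n), exists E : set {m & C m},
         [/\ finite_set E,
             (forall e, E e -> (projT1 e < n)%N) &
             phi n c @` (cube R n `\` open_cube R n)
               `<=` \bigcup_(e in E) open_cell e]) &
      (forall A : set K,
         (forall n (c : C n), closed (cube R n `&` phi n c @^-1` A)) ->
         closed A)].

(* The base point of a based CW complex is a vertex. *)
Definition based_cw_complex (R : realType) (K : ptopologicalType) : Prop :=
  exists (C : nat -> Type) (phi : forall n, C n -> 'rV[R]_n -> K),
    cw_structure phi /\ exists c : C 0%N, forall v, phi 0%N c v = point.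

Definition cw_space (R : realType) (X : ptopologicalType) : Prop :=
  connected [set: X] /\
  exists2 K : ptopologicalType, based_cw_complex R K & same_htype R X K.

(* Reduced mapping cone: the quotient of the disjoint union of B and A x [0,1] by
   (a, 1) ~ f a, (a, 0) ~ * and ( *, t) ~ *.  [cone_glue] sends each point of the
   disjoint union to a representative of its class. *)
Section mapping_cone.
Context (R : realType) (A B : ptopologicalType) (f : A -> B).

Definition cone_part (b : bool) : topologicalType :=
  if b then B : topologicalType else (A * unit_interval R)%type.

Definition cone_base (y : B) : {b & cone_part b} := existT cone_part true y.

Definition cone_glue (z : {b & cone_part b}) : {b & cone_part b} :=
  match z with
  | existT true y => cone_base y
  | existT false p =>
      if p.2 == itv1 R then cone_base (f p.1)
      else if (p.2 == itv0 R) || (p.1 == point) then cone_base point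
      else existT cone_part false p
  end.

Let cone_rel' (z w : {b & cone_part b}) := cone_glue z == cone_glue w.

Local Lemma cone_rel_refl : reflexive cone_rel'.
Proof. by move=> z; exact: eqxx. Qed.

Local Lemma cone_rel_sym : symmetric cone_rel'.
Proof. by move=> z w; exact: eq_sym. Qed.

Local Lemma cone_rel_trans : transitive cone_rel'.
Proof. by move=> w z u /eqP zw /eqP wu; apply/eqP; rewrite zw. Qed.

Definition cone_rel := EquivRel _ cone_rel_refl cone_rel_sym cone_rel_trans.

Definition mapping_cone := {eq_quot cone_rel}.

Definition cone_in (y : B) : mapping_cone :=
  \pi_mapping_cone (cone_base y).

HB.instance Definition _ :=
  Topological.copy mapping_cone (quotient_topology mapping_cone).
HB.instance Definition _ := Quotient.on mapping_cone.
HB.instance Definition _ := isPointed.Build mapping_cone (cone_in point).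

End mapping_cone.

(* A -f-> B -g-> C is a cofiber sequence if, up to homotopy, g is the inclusion
   of B in the mapping cone of f. *)
Definition cofiber_sequence (R : realType) (A B C : ptopologicalType)
    (f : A -> B) (g : B -> C) : Prop :=
  [/\ based_map f, based_map g &
      exists h : mapping_cone R f -> C,
        based_heq R h /\ based_homotopic R (h \o cone_in R f) g].

(* Only X_0, ..., X_m matter in the sequence [Xs]. *)
Definition killing_decomposition (R : realType) (F : ptopologicalType -> Prop)
    (X : ptopologicalType) (m : nat) : Prop :=
  exists Xs : nat -> ptopologicalType,
    [/\ (forall i, (i <= m)%N -> cw_space R (Xs i)),
        same_htype R (Xs 0%N) X,
        same_htype R (Xs m) one_point &
        forall i, (i < m)%N ->
          exists (J : pointedType) (S : J -> ptopologicalType),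
            [/\ (forall j, F (S j)), cw_space R (pwedge S) &
                exists (l : pwedge S -> Xs i) (g : Xs i -> Xs i.+1),
                  cofiber_sequence R l g]].

Definition killing_length (R : realType) (F : ptopologicalType -> Prop)
    (X : ptopologicalType) : \bar R :=
  if pselect (same_htype R X one_point) then 0%E
  else match pselect (exists m, `[< killing_decomposition R F X m >]) with
       | left ex => (ex_minn ex)%:R%:E
       | right _ => +oo%E
       end.

(* Main.v *)
Require Import Defs.
From HB Require Import structures.
From mathcomp Require Import all_boot all_order all_algebra generic_quotient.
From mathcomp Require Import all_classical all_reals all_analysis homotopy.
From mathcomp Require Import lra ring.

(** Let [X -> Y -> Z] be a cofiber sequence and [L_i -> X_i -> X_{i+1}], [i < m],
    a decomposition killing [X].  Put [Y_0 = Y], and attach to [Y] the same cones: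
    [Y_{i+1}] is the cone of the composite [L_i -> X_i -> Y_i].  Coning off [L_i]
    inside [X_i] and inside [Y_i] has the same effect on the quotient, so that
    [X_{i+1} -> Y_{i+1}] has again cofiber [Z] ([same_htype_cone_composite]).  After
    [m] steps [X_m] is contractible, hence [Y_m] has the homotopy type of [Z]
    ([same_htype_cone_contractible]), and the [n] steps that kill [Z] finish the
    work: [Y] is killed in [m + n] steps ([killing_decomposition_cofiber]).

    Two things have to be supplied.

    The first one is formal: the homotopy type of a mapping cone depends only on
    the homotopy class of the map ([same_htype_cone_homotopic]) and may be computed
    after replacing its source or its target by a homotopy equivalent space
    ([same_htype_cone_source], [same_htype_cone_target]).  Homotopies out of a cone
    are defined piecewise; this is legitimate because the product of a quotient map
    with a locally compact space is a quotient map ([cone_continuous2]).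

    The second one is that the spaces [Y_i] have the homotopy type of CW complexes
    ([cw_space_cone]).  By homotopy invariance the map may be replaced by a cellular
    map of CW complexes, whose cone has an evident cell structure
    ([cw_structure_cone]).  Cellular approximation ([cellular_approximation]) is
    proved one cell at a time: a map of the [n]-cube meets finitely many open cells
    ([compact_cells]) and is pushed off those of dimension larger than [n], starting
    with the largest ([compress]).  To push a map off a cell of dimension [m > n] it
    is enough to make it miss one point of the cell; a Lipschitz map from the
    [n]-cube to an [m]-dimensional space does so by a pigeonhole argument
    ([lipschitz_miss]), and every continuous map is close to a Lipschitz one
    ([lipschitz_approx]). *)

Set Implicit Arguments.
Unset Strict Implicit.
Unset Printing Implicit Defensive.

Import Order.TTheory GRing.Theory Num.Theory.
Import numFieldNormedType.Exports.

Local Open Scope classical_set_scope.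
Local Open Scope ring_scope.
Local Open Scope quotient_scope.

(** * Continuous functions given by formulas *)

Section continuity_rules.
Context {T U V W : topologicalType}.

Lemma cont_id : continuous (fun x : T => x).
Proof. by move=> x. Qed.

Lemma cont_cst (c : U) : continuous (fun _ : T => c).
Proof. by move=> x; exact: cvg_cst. Qed.

Lemma cont_comp (f : U -> V) (g : T -> U) :
  continuous f -> continuous g -> continuous (fun x => f (g x)).
Proof. by move=> cf cg x; apply: (@continuous_comp _ _ _ g f); [exact: cg|exact: cf]. Qed.

Lemma cont_pair (f : T -> U) (g : T -> V) :
  continuous f -> continuous g -> continuous (fun x => (f x, g x)).
Proof. by move=> cf cg x; apply: cvg_pair; [exact: cf|exact: cg]. Qed.

Lemma cont_fst (f : T -> U * V) : continuous f -> continuous (fun x => (f x).1).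
Proof. by move=> cf x; apply: (@continuous_comp _ _ _ f fst); [exact: cf|exact: cvg_fst]. Qed.

Lemma cont_snd (f : T -> U * V) : continuous f -> continuous (fun x => (f x).2).
Proof. by move=> cf x; apply: (@continuous_comp _ _ _ f snd); [exact: cf|exact: cvg_snd]. Qed.

End continuity_rules.

Section continuity_rules_real.
Context {R : realType} {T : topologicalType}.
Implicit Types f g : T -> R.

Lemma cont_add f g : continuous f -> continuous g ->
  continuous (fun x => f x + g x).
Proof. by move=> cf cg x; apply: cvgD; [exact: cf|exact: cg]. Qed.

Lemma cont_opp f : continuous f -> continuous (fun x => - f x).
Proof. by move=> cf x; apply: cvgN; exact: cf. Qed.

Lemma cont_mul f g : continuous f -> continuous g ->
  continuous (fun x => f x * g x).
Proof. by move=> cf cg x; apply: cvgM; [exact: cf|exact: cg]. Qed.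

Lemma cont_min f g : continuous f -> continuous g ->
  continuous (fun x => Num.min (f x) (g x)).
Proof. by move=> cf cg x; apply: continuous_min; [exact: cf|exact: cg]. Qed.

Lemma cont_max f g : continuous f -> continuous g ->
  continuous (fun x => Num.max (f x) (g x)).
Proof. by move=> cf cg x; apply: continuous_max; [exact: cf|exact: cg]. Qed.

Definition clamp (r : R) : R := Num.max 0 (Num.min 1 r).

Lemma cont_clamp f : continuous f -> continuous (fun x => clamp (f x)).
Proof.
by move=> cf; apply: cont_max; [exact: cont_cst|apply: cont_min => //; exact: cont_cst].
Qed.

Lemma cont_norm f : continuous f -> continuous (fun x => `|f x|).
Proof. by move=> cf x; apply: cvg_norm; exact: cf. Qed.

Lemma cont_inv f : (forall x, f x != 0) -> continuous f ->
  continuous (fun x => (f x)^-1).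
Proof. by move=> f0 cf x; apply: cvgV; [exact: f0|exact: cf]. Qed.

Lemma cont_if {U : topologicalType} (f g : T -> R) (u v : T -> U) :
    continuous f -> continuous g -> continuous u -> continuous v ->
    (forall x, f x = g x -> u x = v x) ->
  continuous (fun x => if f x <= g x then u x else v x).
Proof.
move=> cf cg cu cv uv.
set w := fun x => _.
pose A := [set x | f x - g x <= 0]; pose B := [set x | 0 <= f x - g x].
have cfg : continuous (fun x => f x - g x) by apply: cont_add => //; exact: cont_opp.
have clA : closed A.
  by apply: (@preimage_closed _ _ (fun x => f x - g x) [set r | r <= 0]);
    [move=> x _; exact: cfg|exact: closed_le].
have clB : closed B.
  by apply: (@preimage_closed _ _ (fun x => f x - g x) [set r | 0 <= r]);
    [move=> x _; exact: cfg|exact: closed_ge].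
have AB : A `|` B = setT.
  by apply/seteqP; split => // x _; case: (leP (f x - g x) 0) => h; [left|right; exact: ltW].
apply/continuous_subspace_setT; rewrite -AB; apply: withinU_continuous => //.
  apply: (@subspace_eq_continuous _ A _ u); last exact: continuous_subspaceT.
  by move=> x /set_mem; rewrite /A /= subr_le0 => h; rewrite /from_subspace /w h.
apply: (@subspace_eq_continuous _ B _ v); last exact: continuous_subspaceT.
move=> x /set_mem; rewrite /B /= subr_ge0 => gf; rewrite /from_subspace /w.
case: ifP => // fg; by apply/esym/uv/le_anti; rewrite fg gf.
Qed.

End continuity_rules_real.

Section continuity_rules_vector.
Context {R : realType} {T : topologicalType} {n : nat}.
Implicit Types f g : T -> 'rV[R]_n.

Lemma cont_addv f g : continuous f -> continuous g ->
  continuous (fun x => f x + g x).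
Proof. by move=> cf cg x; apply: cvgD; [exact: cf|exact: cg]. Qed.

Lemma cont_oppv f : continuous f -> continuous (fun x => - f x).
Proof. by move=> cf x; apply: cvgN; exact: cf. Qed.

Lemma cont_scale (k : T -> R) f : continuous k -> continuous f ->
  continuous (fun x => k x *: f x).
Proof. by move=> ck cf x; apply: cvgZ; [exact: ck|exact: cf]. Qed.

Lemma cont_normv f : continuous f -> continuous (fun x => `|f x|).
Proof. by move=> cf x; apply: cvg_norm; exact: cf. Qed.

Lemma cont_row f : (forall i, continuous (fun x => f x 0 i)) -> continuous f.
Proof.
move=> cf x A /nbhs_ballP [e /= e0 eA].
have : \forall y \near x, forall i, ball (f x 0 i) e (f y 0 i).
  by apply: filter_forall => i; apply: cf; exact: nbhsx_ballx.
by apply: filterS => y h; apply: eA; split => // i j; rewrite ord1; exact: h.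
Qed.

End continuity_rules_vector.

(** Proves the continuity of a function by following the syntax of its body;
    functions in head position are looked up among the hypotheses. *)
Ltac cont_step := lazymatch goal with
  | H : continuous ?f |- continuous ?f => exact: H
  | |- continuous ?h => lazymatch h with
    | (fun x => x) => exact: cont_id
    | (fun _ => ?c) => exact: cont_cst
    | (fun x => (_, _)) => apply: cont_pair
    | @Num.norm _ _ => move=> ?; exact: norm_continuous
    | @fst _ _ => move=> ?; exact: cvg_fst
    | @snd _ _ => move=> ?; exact: cvg_snd
    | (fun x => fst _) => apply: cont_fst
    | (fun x => snd _) => apply: cont_snd
    | (fun x => (_ + _)%R) => first [apply: cont_add|apply: cont_addv]
    | (fun x => (- _)%R) => first [apply: cont_opp|apply: cont_oppv]
    | (fun x => (_ * _)%R) => apply: cont_mul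
    | (fun x => Num.min _ _) => apply: cont_min
    | (fun x => Num.max _ _) => apply: cont_max
    | (fun x => clamp _) => apply: cont_clamp
    | (fun x => `|_|) => first [apply: cont_norm|apply: cont_normv]
    | (fun x => _ *: _) => apply: cont_scale
    | (fun x => ?f _) => lazymatch goal with H : continuous f |- _ => apply: (cont_comp H) end
    end
  end.
Ltac cont := repeat cont_step.

Section interval.
Context {R : realType}.
Implicit Types r : R.

Lemma clamp_ge0 r : 0 <= clamp r. Proof. by rewrite /clamp le_max lexx. Qed.
Lemma clamp_le1 r : clamp r <= 1.
Proof. by rewrite /clamp ge_max ler01 ge_min lexx. Qed.
Lemma clamp_id r : 0 <= r -> r <= 1 -> clamp r = r.
Proof. by move=> r0 r1; rewrite /clamp (min_idPr r1) (max_idPr r0). Qed.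
Lemma clamp_le0 r : r <= 0 -> clamp r = 0.
Proof.
by move=> r0; rewrite /clamp (min_idPr (le_trans r0 ler01)) (max_idPl r0).
Qed.
Lemma clamp_ge1 r : 1 <= r -> clamp r = 1.
Proof. by move=> r1; rewrite /clamp (min_idPl r1) (max_idPr ler01). Qed.
Lemma clamp0 : clamp 0 = 0 :> R. Proof. exact: clamp_le0. Qed.
Lemma clamp1 : clamp 1 = 1 :> R. Proof. exact: clamp_ge1. Qed.
Lemma clamp_mem r : clamp r \in `[(0 : R), 1]%classic.
Proof. by rewrite inE /= in_itv /= clamp_ge0 clamp_le1. Qed.

Definition to_itv (r : R) : unit_interval R := exist _ (clamp r) (clamp_mem r).
Definition of_itv (t : unit_interval R) : R := set_val t.

Lemma of_itvK t : to_itv (of_itv t) = t.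
Proof.
case: t => r ri; apply: eq_sig_hprop => /=; first by move=> ? ? ?; exact: bool_irrelevance.
have := ri; rewrite inE /= in_itv /= => /andP[r0 r1]; exact: clamp_id.
Qed.
Lemma to_itvK r : of_itv (to_itv r) = clamp r. Proof. by []. Qed.
Lemma of_itv_ge0 t : 0 <= of_itv t.
Proof. by rewrite -(of_itvK t) to_itvK clamp_ge0. Qed.
Lemma of_itv_le1 t : of_itv t <= 1.
Proof. by rewrite -(of_itvK t) to_itvK clamp_le1. Qed.
Lemma to_itv0 r : r <= 0 -> to_itv r = itv0 R.
Proof. by move=> r0; apply: eq_sig_hprop => /=; [move=> ? ? ?; exact: bool_irrelevance|exact: clamp_le0]. Qed.
Lemma to_itv1 r : 1 <= r -> to_itv r = itv1 R.
Proof. by move=> r0; apply: eq_sig_hprop => /=; [move=> ? ? ?; exact: bool_irrelevance|exact: clamp_ge1]. Qed.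
Lemma of_itv0 : of_itv (itv0 R) = 0. Proof. by []. Qed.
Lemma of_itv1 : of_itv (itv1 R) = 1. Proof. by []. Qed.

Lemma continuous_of_itv : continuous of_itv.
Proof. exact: initial_continuous. Qed.

Lemma continuous_to_itv : continuous to_itv.
Proof. by apply: continuous_comp_initial; apply: cont_clamp; exact: cont_id. Qed.

End interval.

Section locally_compact_spaces.

Lemma locally_compact_prod (T U : topologicalType) :
  locally_compact [set: T] -> locally_compact [set: U] ->
  locally_compact [set: T * U].
Proof.
move=> lT lU [x y] _.
have [B] := lT x I; rewrite withinET => Bx [cB clB].
have [C] := lU y I; rewrite withinET => Cy [cC clC].
exists (B `*` C); first by rewrite withinET; exists (B, C).
split; first exact: compact_setX.
by apply: closedI; apply: preimage_closed => //; move=> z _; [exact: cvg_fst|exact: cvg_snd].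
Qed.

End locally_compact_spaces.

(** * Mapping cones *)

Section cone.
Context {R : realType} {A B : ptopologicalType} (f : A -> B).
Local Notation C := (mapping_cone R f).

Definition cone_pt (p : A * R) : C :=
  \pi_(mapping_cone R f) (existT (cone_part R A B) false (p.1, to_itv p.2)).

Lemma cone_piP (z w : {b & cone_part R A B b}) :
  \pi_(mapping_cone R f) z = \pi_(mapping_cone R f) w <->
  cone_glue f z = cone_glue f w.
Proof. by split => [/eqmodP/eqP|h]; [|apply/eqmodP/eqP]. Qed.

Lemma cone_pt1 x r : 1 <= r -> cone_pt (x, r) = cone_in R f (f x).
Proof. by move=> r1; apply/cone_piP; rewrite /= to_itv1 // eqxx. Qed.

Lemma itv01_neq : (itv0 R == itv1 R) = false.
Proof. by apply/eqP => /(congr1 of_itv)/eqP; rewrite of_itv0 of_itv1 eq_sym oner_eq0. Qed.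

Lemma cone_pt0 x r : r <= 0 -> cone_pt (x, r) = point.
Proof. by move=> r0; apply/cone_piP; rewrite /= to_itv0 // itv01_neq eqxx. Qed.

Lemma cone_ptb r : f point = point -> cone_pt (point, r) = point.
Proof.
by move=> fp; apply/cone_piP; rewrite /= fp eqxx orbT; case: ifP.
Qed.

Lemma cone_pt_clamp x r : cone_pt (x, clamp r) = cone_pt (x, r).
Proof. by rewrite /cone_pt /= (_ : to_itv (clamp r) = to_itv r) //; exact: (of_itvK (to_itv r)). Qed.

Lemma cone_ind (P : C -> Prop) :
    (forall y, P (cone_in R f y)) ->
    (forall x r, x <> point -> 0 < r -> r < 1 -> P (cone_pt (x, r))) ->
  forall z, P z.
Proof.
move=> Pin Ppt z; rewrite -[z]reprK; case: (repr z) => -[y|[x t]]; first exact: Pin.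
rewrite (_ : \pi_C _ = cone_pt (x, of_itv t)); last first.
  by rewrite /cone_pt /= of_itvK.
have [t1|t1] := leP 1 (of_itv t); first by rewrite cone_pt1.
have [t0|t0] := leP (of_itv t) 0; first by rewrite cone_pt0 //; exact: Pin.
have [xp|xp] := eqVneq x point; last by apply: Ppt => //; apply/eqP.
suff -> : cone_pt (x, of_itv t) = point by exact: Pin.
apply/cone_piP; rewrite /= xp eqxx orbT; case: ifP => // /eqP h.
by move: t1; rewrite -(of_itvK t) h of_itv1 ltxx.
Qed.

Lemma continuous_cone_in : continuous (cone_in R f).
Proof.
apply: (cont_comp (f := \pi_(mapping_cone R f))); first exact: pi_continuous.
exact: (@existT_continuous bool (cone_part R A B) true).
Qed.

Lemma continuous_cone_pt : continuous cone_pt.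
Proof.
apply: (cont_comp (f := \pi_(mapping_cone R f))); first exact: pi_continuous.
apply: (cont_comp (f := existT (cone_part R A B) false)).
  exact: (@existT_continuous bool (cone_part R A B) false).
have cti := @continuous_to_itv R; apply: (@cont_pair _ A (unit_interval R)); cont.
Qed.

Lemma cone_continuous {W : topologicalType} (F : C -> W) :
    continuous (fun y => F (cone_in R f y)) ->
    continuous (fun p => F (cone_pt p)) ->
  continuous F.
Proof.
move=> cin cpt; apply/quotient_continuous.
suff cF b : continuous (fun z : cone_part R A B b =>
    F (\pi_(mapping_cone R f) (existT (cone_part R A B) b z))).
  by move=> [b z] U nU; apply: existT_continuous; exact: (cF b).
case: b; first exact: cin.
have ct := @continuous_of_itv R.
rewrite (_ : (fun z => _) = (fun p : A * unit_interval R =>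
    F (cone_pt (p.1, of_itv p.2))) :> (cone_part R A B false -> W)); last first.
  by apply/funext => -[x t]; rewrite /cone_pt /= of_itvK.
apply: (cont_comp cpt); apply: (@cont_pair (A * unit_interval R)%type A R); cont.
Qed.

(** For a locally compact parameter space [T], the functor [- * T] preserves the
    quotient that defines the cone; this is what makes homotopies out of a cone
    computable piece by piece. *)
Lemma cone_continuous2 {T W : topologicalType} (F : C * T -> W) :
    locally_compact [set: T] -> hausdorff_space T ->
    continuous (fun p : B * T => F (cone_in R f p.1, p.2)) ->
    continuous (fun p : (A * R) * T => F (cone_pt p.1, p.2)) ->
  continuous F.
Proof.
move=> lT hT cin cpt.
have [cin1 cin2] := continuous_curry cin.
have [cpt1 cpt2] := continuous_curry cpt.
rewrite (_ : F = uncurry (curry F)); last by apply/funext => -[].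
apply: continuous_uncurry => //.
  exact: (@cone_continuous {compact-open, T -> W} (curry F)).
elim/cone_ind => [y|x r _ _ _]; [exact: (cin2 y)|exact: (cpt2 (x, r))].
Qed.

(** Computed on representatives, hence meaningful only under the compatibility
    conditions [H1], [H0] and [Hb] below. *)
Definition cone_lift {W : Type} (u : B -> W) (H : A * R -> W) (z : C) : W :=
  match repr z with
  | existT true y => u y
  | existT false p => H (p.1, of_itv p.2)
  end.

Section cone_lift.
Context {W : Type} (u : B -> W) (H : A * R -> W).
Hypotheses (H1 : forall x, H (x, 1) = u (f x)) (H0 : forall x, H (x, 0) = u point).
Hypothesis Hb : forall r, 0 <= r -> r <= 1 -> H (point, r) = u point.

Let lift_pre (z : {b & cone_part R A B b}) :=
  match z with existT true y => u y | existT false p => H (p.1, of_itv p.2) end.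

Let lift_glue z : lift_pre (cone_glue f z) = lift_pre z.
Proof.
case: z => -[//|[x t]] /=; case: eqVneq => [->|t1] /=; first by rewrite of_itv1 H1.
case: eqVneq => [->|t0] /=; first by rewrite of_itv0 H0.
case: eqVneq => [->|//] /=; by rewrite Hb // ?of_itv_ge0 ?of_itv_le1.
Qed.

Let liftE z : cone_lift u H (\pi_(mapping_cone R f) z) = lift_pre z.
Proof.
have /cone_piP h := reprK (\pi_(mapping_cone R f) z).
by rewrite -(lift_glue z) -h lift_glue.
Qed.

Lemma cone_lift_in y : cone_lift u H (cone_in R f y) = u y.
Proof. exact: liftE. Qed.

Lemma cone_lift_pt x r : cone_lift u H (cone_pt (x, r)) = H (x, clamp r).
Proof. exact: liftE. Qed.

End cone_lift.

End cone.

(** * Based homotopy equivalences *)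

Section homotopy.
Context {R : realType}.
Implicit Types X Y Z W : ptopologicalType.

Lemma homotopic_by X Y (f g : X -> Y) (H : X * R -> Y) :
    continuous H -> (forall x, H (x, 0) = f x) -> (forall x, H (x, 1) = g x) ->
    (forall r, 0 <= r -> r <= 1 -> H (point, r) = point) ->
  based_homotopic R f g.
Proof.
move=> cH H0 H1 Hp; exists (fun p => H (p.1, of_itv p.2)); split.
- by have ci := @continuous_of_itv R; cont.
- by move=> x; rewrite /= of_itv0.
- by move=> x; rewrite /= of_itv1.
- by move=> t; apply: Hp; [exact: of_itv_ge0|exact: of_itv_le1].
Qed.

Lemma homotopic_ext X Y (f g : X -> Y) : based_homotopic R f g ->
  exists H : X * R -> Y, [/\ continuous H,
    forall x r, r <= 0 -> H (x, r) = f x, forall x r, 1 <= r -> H (x, r) = g x &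
    forall r, H (point, r) = point].
Proof.
move=> [H [cH H0 H1 Hp]]; exists (fun p => H (p.1, to_itv p.2)); split => //=.
- by have ci := @continuous_to_itv R; cont.
- by move=> x r r0; rewrite to_itv0.
- by move=> x r r0; rewrite to_itv1.
Qed.

Lemma homotopic_refl X Y (f : X -> Y) : based_map f -> based_homotopic R f f.
Proof. by move=> [cf fp]; apply: (@homotopic_by _ _ _ _ (fun p => f p.1)) => //; cont. Qed.

Lemma homotopic_sym X Y (f g : X -> Y) :
  based_homotopic R f g -> based_homotopic R g f.
Proof.
move=> /homotopic_ext [H [cH H0 H1 Hp]].
apply: (@homotopic_by _ _ _ _ (fun p => H (p.1, 1 - p.2))) => /=; first by cont.
- by move=> x; rewrite H1 ?subr0.
- by move=> x; rewrite H0 ?subrr.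
- by move=> *; rewrite Hp.
Qed.

Lemma homotopic_trans X Y (f g h : X -> Y) :
  based_homotopic R f g -> based_homotopic R g h -> based_homotopic R f h.
Proof.
move=> /homotopic_ext [H [cH H0 H1 Hp]] /homotopic_ext [K [cK K0 K1 Kp]].
pose L p := if p.2 * 2 <= 1 then H (p.1, p.2 * 2) else K (p.1, p.2 * 2 - 1).
apply: (@homotopic_by _ _ _ _ L) => /=.
- apply: cont_if; try by cont.
  by move=> [x r] /= ->; rewrite subrr H1 // K0.
- by move=> x; rewrite /L /= mul0r ler01 H0.
- by move=> x; rewrite /L /= ifF ?K1 //; [lra|apply/negbTE; rewrite -ltNge; lra].
- by move=> r _ _; rewrite /L /=; case: ifP; rewrite ?Hp ?Kp.
Qed.

Lemma homotopic_comp X Y Z (f f' : X -> Y) (g g' : Y -> Z) :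
    based_homotopic R f f' -> based_homotopic R g g' ->
  based_homotopic R (g \o f) (g' \o f').
Proof.
move=> /homotopic_ext [H [cH H0 H1 Hp]] /homotopic_ext [K [cK K0 K1 Kp]].
apply: (@homotopic_by _ _ _ _ (fun p => K (H p, p.2))) => /=; first by cont.
- by move=> x; rewrite H0 // K0.
- by move=> x; rewrite H1 // K1.
- by move=> r _ _; rewrite Hp Kp.
Qed.

Lemma based_map_id X : based_map (@id X).
Proof. by split => // x. Qed.

Lemma based_map_comp X Y Z (f : X -> Y) (g : Y -> Z) :
  based_map f -> based_map g -> based_map (g \o f).
Proof. by move=> [cf fp] [cg gp]; split; [exact: (cont_comp cg cf)|rewrite /= fp gp]. Qed.

Lemma homotopic_compl X Y Z (f f' : X -> Y) (g : Y -> Z) : based_map g ->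
  based_homotopic R f f' -> based_homotopic R (g \o f) (g \o f').
Proof. by move=> bg ff'; apply: homotopic_comp => //; exact: homotopic_refl. Qed.

Lemma homotopic_compr X Y Z (f : X -> Y) (g g' : Y -> Z) : based_map f ->
  based_homotopic R g g' -> based_homotopic R (g \o f) (g' \o f).
Proof. by move=> bf gg'; apply: homotopic_comp => //; exact: homotopic_refl. Qed.

Lemma heq_id X : based_heq R (@id X).
Proof.
split; first exact: based_map_id.
by exists id; split; first exact: based_map_id; apply: homotopic_refl; exact: based_map_id.
Qed.

Lemma heq_comp X Y Z (f : X -> Y) (g : Y -> Z) :
  based_heq R f -> based_heq R g -> based_heq R (g \o f).
Proof.
move=> [bf [f' [bf' ff' f'f]]] [bg [g' [bg' gg' g'g]]].
split; first exact: based_map_comp.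
exists (f' \o g'); split; first exact: based_map_comp.
- apply: (homotopic_trans (g := f' \o f)) => //.
  exact: (homotopic_compl (f := (g' \o g) \o f) bf' (homotopic_compr bf gg')).
- apply: (homotopic_trans (g := g \o g')) => //.
  exact: (homotopic_compl (f := (f \o f') \o g') bg (homotopic_compr bg' f'f)).
Qed.

Lemma heq_homotopic X Y (f g : X -> Y) : based_map g ->
  based_homotopic R f g -> based_heq R f -> based_heq R g.
Proof.
move=> bg fg [bf [f' [bf' ff' f'f]]]; split => //; exists f'; split => //.
- by apply: homotopic_trans ff'; apply: homotopic_compl => //; exact: homotopic_sym.
- by apply: homotopic_trans f'f; apply: homotopic_compr => //; exact: homotopic_sym.
Qed.

Lemma heq_inv X Y (f : X -> Y) : based_heq R f -> 
  exists g : Y -> X, [/\ based_heq R g, based_homotopic R (g \o f) id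
    & based_homotopic R (f \o g) id].
Proof.
by move=> [bf [g [bg gf fg]]]; exists g; split => //; split => //; exists f; split.
Qed.

Lemma heq_inverse X Y (f : X -> Y) (g h : Y -> X) :
    based_map f -> based_map g -> based_map h ->
    based_homotopic R (g \o f) id -> based_homotopic R (f \o h) id ->
  based_heq R f.
Proof.
move=> bf bg bh gf fh; split => //; exists g; split => //.
apply: (homotopic_trans _ fh); apply: homotopic_compl => //.
apply: (homotopic_trans (g := g \o f \o h)); last exact: (homotopic_compr bh gf).
by apply: homotopic_sym; exact: (homotopic_compl bg fh).
Qed.

(** The two-out-of-six property, from which the maps of cones induced by homotopy
    equivalences are recognized without computing their inverses. *)
Lemma heq_2of6 X Y Z W (c : X -> Y) (b : Y -> Z) (a : Z -> W) :
    based_map a -> based_map b -> based_map c ->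
    based_heq R (a \o b) -> based_heq R (b \o c) ->
  [/\ based_heq R a, based_heq R b & based_heq R c].
Proof.
move=> ba bb bc hab hbc.
have [p [[bp _] pab abp]] := heq_inv hab.
have [q [[bq _] qbc bcq]] := heq_inv hbc.
have hb : based_heq R b.
  by apply: (@heq_inverse _ _ b (p \o a) (c \o q)) => //; exact: based_map_comp.
have [b' [hb' b'b bb']] := heq_inv hb; have [bb'' _] := hb'.
split => //.
- apply: (@heq_homotopic _ _ ((a \o b) \o b')) => //; last exact: heq_comp.
  exact: (homotopic_compl (f := b \o b') ba bb').
- apply: (@heq_homotopic _ _ (b' \o (b \o c))) => //; last exact: heq_comp.
  exact: (homotopic_compr bc b'b).
Qed.

Lemma same_htype_refl X : same_htype R X X.
Proof. by exists id; exact: heq_id. Qed.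

Lemma same_htype_sym X Y : same_htype R X Y -> same_htype R Y X.
Proof. by move=> [f /heq_inv [g [hg _ _]]]; exists g. Qed.

Lemma same_htype_trans X Y Z :
  same_htype R X Y -> same_htype R Y Z -> same_htype R X Z.
Proof. by move=> [f hf] [g hg]; exists (g \o f); exact: heq_comp. Qed.

End homotopy.

(** * Homotopy invariance of the mapping cone *)

Section cone_maps.
Context {R : realType}.
Implicit Types A B W : ptopologicalType.

Lemma cone_lift_cont2 A B (f : A -> B) (T W : topologicalType) (u : B * T -> W)
    (H : (A * R) * T -> W) :
    locally_compact [set: T] -> hausdorff_space T ->
    continuous u -> continuous H ->
    (forall x t, H ((x, 1), t) = u (f x, t)) ->
    (forall x t, H ((x, 0), t) = u (point, t)) ->
    (forall r t, 0 <= r -> r <= 1 -> H ((point, r), t) = u (point, t)) ->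
  continuous (fun p : mapping_cone R f * T =>
    cone_lift (fun y => u (y, p.2)) (fun q => H (q, p.2)) p.1).
Proof.
move=> lT hT cu cH H1 H0 Hb.
have Ein t y := @cone_lift_in R A B f W (fun y => u (y, t)) (fun q => H (q, t))
  (H1^~ t) (H0^~ t) (Hb^~ t) y.
have Ept t x r := @cone_lift_pt R A B f W (fun y => u (y, t)) (fun q => H (q, t))
  (H1^~ t) (H0^~ t) (Hb^~ t) x r.
apply: cone_continuous2 => //.
  rewrite (_ : (fun p => _) = (fun p => u (p.1, p.2))); first by cont.
  by apply/funext => -[y t] /=; rewrite Ein.
rewrite (_ : (fun p => _) = (fun p => H ((p.1.1, clamp p.1.2), p.2))).
  by cont.
by apply/funext => -[[x r] t] /=; rewrite Ept.
Qed.

Lemma based_cone_lift A B W (f : A -> B) (u : B -> W) (H : A * R -> W) :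
    based_map u -> continuous H ->
    (forall x, H (x, 1) = u (f x)) -> (forall x, H (x, 0) = point) ->
    (forall r, 0 <= r -> r <= 1 -> H (point, r) = point) ->
  based_map (cone_lift u H : mapping_cone R f -> W).
Proof.
move=> [cu up] cH H1 H0 Hb.
have H0' x : H (x, 0) = u point by rewrite up.
have Hb' r : 0 <= r -> r <= 1 -> H (point, r) = u point by rewrite up; exact: Hb.
split; last by rewrite cone_lift_in.
apply: cone_continuous.
  by rewrite (_ : (fun y => _) = u) //; apply/funext => y; rewrite cone_lift_in.
rewrite (_ : (fun p => _) = (fun p => H (p.1, clamp p.2))).
  by cont.
by apply/funext => -[x r] /=; rewrite cone_lift_pt.
Qed.

(** The only way in which homotopies out of a cone are built here: the identities
    expressing the compatibility of [u] and [H] are left to be checked. *)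
Lemma homotopic_cone A B W (f : A -> B) (k l : mapping_cone R f -> W)
    (u : B * R -> W) (H : (A * R) * R -> W) :
    continuous u -> continuous H ->
    (forall x t, H ((x, 1), t) = u (f x, t)) ->
    (forall x t, H ((x, 0), t) = point) ->
    (forall r t, 0 <= r -> r <= 1 -> H ((point, r), t) = point) ->
    (forall t, u (point, t) = point) ->
    (forall y, k (cone_in R f y) = u (y, 0)) ->
    (forall y, l (cone_in R f y) = u (y, 1)) ->
    (forall x r, 0 <= r -> r <= 1 -> k (cone_pt f (x, r)) = H ((x, r), 0)) ->
    (forall x r, 0 <= r -> r <= 1 -> l (cone_pt f (x, r)) = H ((x, r), 1)) ->
  based_homotopic R k l.
Proof.
move=> cu cH H1 H0 Hb up ku lu kH lH.
have H0' x t : H ((x, 0), t) = u (point, t) by rewrite up.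
have Hb' r t : 0 <= r -> r <= 1 -> H ((point, r), t) = u (point, t).
  by rewrite up; exact: Hb.
have Ein t y := @cone_lift_in R A B f W (fun y => u (y, t)) (fun q => H (q, t))
  (H1^~ t) (H0'^~ t) (Hb'^~ t) y.
have Ept t x r := @cone_lift_pt R A B f W (fun y => u (y, t)) (fun q => H (q, t))
  (H1^~ t) (H0'^~ t) (Hb'^~ t) x r.
apply: (@homotopic_by _ _ _ _ _ (fun p => 
  cone_lift (fun y => u (y, p.2)) (fun q => H (q, p.2)) p.1)).
- by apply: cone_lift_cont2 => //; first [exact: locally_compactR|exact: Rhausdorff].
- elim/(@cone_ind R A B f) => [y|x r _ r0 r1] /=; first by rewrite Ein.
  by rewrite Ept ?clamp_id ?kH // ltW.
- elim/(@cone_ind R A B f) => [y|x r _ r0 r1] /=; first by rewrite Ein.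
  by rewrite Ept ?clamp_id ?lH // ltW.
- by move=> t _ _ /=; rewrite Ein.
Qed.

End cone_maps.

Section twist.
Context {R : realType} {A B : ptopologicalType} (f : A -> B) (G : A * R -> B).
Hypotheses (bf : based_map f) (cG : continuous G).
Hypotheses (G0 : forall x r, r <= 0 -> G (x, r) = f x) (Gp : forall r, G (point, r) = point).

(** The path from the base point to [G (x, 1)], through the generator of [x] and then
    along the homotopy; it has length 2. *)
Definition twist_path (p : A * R) : mapping_cone R f :=
  if p.2 <= 1 then cone_pt f p else cone_in R f (G (p.1, p.2 - 1)).

Lemma continuous_twist_path : continuous twist_path.
Proof.
have cpt := @continuous_cone_pt R _ _ f; have cin := @continuous_cone_in R _ _ f.
apply: cont_if; try by cont.
by move=> [x r] /= ->; rewrite subrr G0 // cone_pt1.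
Qed.

Lemma twist_path0 x r : r <= 0 -> twist_path (x, r) = point.
Proof. by move=> r0; rewrite /twist_path /= (le_trans r0 ler01) cone_pt0. Qed.

Lemma twist_pathb r : twist_path (point, r) = point.
Proof. by rewrite /twist_path /=; case: ifP; rewrite ?cone_ptb ?Gp //; case: bf. Qed.

Lemma twist_path_pt x r : r <= 1 -> twist_path (x, r) = cone_pt f (x, r).
Proof. by rewrite /twist_path /= => ->. Qed.

Lemma twist_path_in x r : 0 <= r -> twist_path (x, 1 + r) = cone_in R f (G (x, r)).
Proof.
move=> r0; rewrite /twist_path /=; case: ifP => r1; last by rewrite addrAC subrr add0r.
have -> : r = 0 by lra.
by rewrite addr0 cone_pt1 // G0.
Qed.

(** The comparison of the cones of two homotopic maps that runs through the
    homotopy on the outer half of the cylinder. *)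
Definition twist (g : A -> B) : mapping_cone R g -> mapping_cone R f :=
  cone_lift (cone_in R f) (fun p => twist_path (p.1, p.2 * 2)).
Arguments twist g _ : clear implicits.

Context (g : A -> B).
Hypothesis (G1 : forall x, G (x, 1) = g x).

Let twist1 x : twist_path (x, 1 * 2) = cone_in R f (g x).
Proof. by rewrite mul1r (_ : 2 = 1 + 1) // twist_path_in // G1. Qed.

Let twist0 x : twist_path (x, 0 * 2) = point.
Proof. by rewrite mul0r twist_path0. Qed.

Lemma twist_in y : twist g (cone_in R g y) = cone_in R f y.
Proof. by rewrite /twist cone_lift_in // => *; rewrite /= twist_pathb. Qed.

Lemma twist_pt x r : 0 <= r -> r <= 1 ->
  twist g (cone_pt g (x, r)) = twist_path (x, r * 2).
Proof.
by move=> r0 r1; rewrite /twist cone_lift_pt ?clamp_id // => *; rewrite /= twist_pathb.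
Qed.

Lemma based_twist : based_map (twist g).
Proof.
apply: based_cone_lift => //=.
- by split => //; exact: continuous_cone_in.
- by have ct := continuous_twist_path; cont.
- by move=> *; rewrite twist_pathb.
Qed.

End twist.
Arguments twist {R A B} f G g _.

Section homotopic_maps.
Context {R : realType} {A B : ptopologicalType} (f g : A -> B) (G : A * R -> B).
Hypotheses (bf : based_map f) (bg : based_map g) (cG : continuous G).
Hypotheses (G0 : forall x r, r <= 0 -> G (x, r) = f x)
  (G1 : forall x r, 1 <= r -> G (x, r) = g x) (Gp : forall r, G (point, r) = point).
Let G' (p : A * R) := G (p.1, 1 - p.2).

(** The composite follows [twist_path] forth and back along the homotopy, so it is
    a reparametrization of the identity. *)
Lemma twistK : based_homotopic R (twist f G g \o twist g G' f) id.
Proof.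
have G11 x : G (x, 1) = g x by rewrite G1.
have G'1 x : G' (x, 1) = f x by rewrite /G' /= G0 // subrr.
have G'0 x r : r <= 0 -> G' (x, r) = g x by move=> r0; rewrite /G' /= G1 // lerBrDl; lra.
have G'p r : G' (point, r) = point by rewrite /G' /= Gp.
(* position on [twist_path] of the image of height [r]: up to 2 for [r = 1/2],
   then back to 1 *)
pose rho (r : R) : R := Num.min (4 * r) (3 - 2 * r).
have ct := continuous_twist_path cG G0.
apply: (@homotopic_cone _ _ _ _ f _ _ (fun p => cone_in R f p.1) (fun p =>
  twist_path f G (p.1.1, (1 - p.2) * rho p.1.2 + p.2 * p.1.2))) => /=.
- by have cin := @continuous_cone_in R _ _ f; cont.
- by rewrite /rho; cont.
- move=> x t; rewrite (_ : _ + _ = 1) ?twist_path_pt ?cone_pt1 //.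
  by rewrite /rho min_r; [ring|lra].
- by move=> x t; rewrite twist_path0 // /rho min_l; last (by lra); rewrite ?mulr0 ?addr0.
- by move=> r t _ _; rewrite twist_pathb.
- by [].
- by move=> y; rewrite !twist_in.
- by move=> y.
- move=> x r r0 r1; rewrite twist_pt // mul0r addr0 subr0 mul1r /rho.
  have [h|h] := leP (r * 2) 1.
    rewrite twist_path_pt // twist_pt //; last by lra.
    by rewrite min_l; [congr (twist_path _ _ (_, _)); ring|lra].
  rewrite (_ : r * 2 = 1 + (r * 2 - 1)); last by ring.
  rewrite twist_path_in //; last by lra.
  rewrite twist_in // /G' /= min_r; last by lra.
  rewrite (_ : 3 - 2 * r = 1 + (1 - (r * 2 - 1))); last by ring.
  by rewrite twist_path_in //; lra.
- by move=> x r r0 r1; rewrite subrr mul0r add0r mul1r twist_path_pt.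
Qed.

End homotopic_maps.

Lemma heq_twist {R : realType} {A B : ptopologicalType} (f g : A -> B)
    (G : A * R -> B) :
    based_map f -> based_map g -> continuous G ->
    (forall x r, r <= 0 -> G (x, r) = f x) ->
    (forall x r, 1 <= r -> G (x, r) = g x) -> (forall r, G (point, r) = point) ->
  based_heq R (twist f G g).
Proof.
move=> bf bg cG G0 G1 Gp.
pose G' (p : A * R) := G (p.1, 1 - p.2).
have cG' : continuous G' by rewrite /G'; cont.
have G'0 x r : r <= 0 -> G' (x, r) = g x by move=> r0; rewrite /G' /= G1 //; lra.
have G'1 x r : 1 <= r -> G' (x, r) = f x by move=> r0; rewrite /G' /= G0 //; lra.
have G'p r : G' (point, r) = point by rewrite /G' /= Gp.
apply: (@heq_inverse _ _ _ _ (twist g G' f) (twist g G' f)).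
- by apply: based_twist => // x; rewrite G1.
- by apply: based_twist => // x; rewrite G'1.
- by apply: based_twist => // x; rewrite G'1.
- have := twistK bg bf cG' G'0 G'1 G'p; congr (based_homotopic R (_ \o twist _ _ _) _).
  by apply/funext => -[x r]; rewrite /G' /= subKr.
- exact: twistK.
Qed.

Section cone_functoriality.
Context {R : realType}.
Implicit Types A B : ptopologicalType.

Lemma same_htype_cone_homotopic A B (f g : A -> B) : based_map f -> based_map g ->
  based_homotopic R f g -> same_htype R (mapping_cone R g) (mapping_cone R f).
Proof.
move=> bf bg /homotopic_ext [G [cG G0 G1 Gp]].
by exists (twist f G g); exact: heq_twist.
Qed.

Definition cone_pre A' A B (f : A -> B) (e : A' -> A) :
    mapping_cone R (f \o e) -> mapping_cone R f :=
  cone_lift (cone_in R f) (fun p => cone_pt f (e p.1, p.2)).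

Section cone_pre.
Context {A' A B : ptopologicalType} (f : A -> B) (e : A' -> A).
Hypotheses (bf : based_map f) (be : based_map e).

Let pre1 x : cone_pt f (e x, 1) = cone_in R f ((f \o e) x).
Proof. by rewrite cone_pt1. Qed.
Let pre0 x : cone_pt f (e x, 0) = cone_in R f point.
Proof. by rewrite cone_pt0. Qed.
Let preb (r : R) : 0 <= r -> r <= 1 -> cone_pt f (e point, r) = cone_in R f point.
Proof. by case: bf be => [_ fp] [_ ->]; rewrite cone_ptb. Qed.

Lemma cone_pre_in y : cone_pre (cone_in R (f \o e) y) = cone_in R f y.
Proof. exact: cone_lift_in. Qed.

Lemma cone_pre_pt x r : cone_pre (cone_pt (f \o e) (x, r)) = cone_pt f (e x, r).
Proof. by rewrite /cone_pre cone_lift_pt // cone_pt_clamp. Qed.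

Lemma based_cone_pre : based_map (@cone_pre _ _ _ f e).
Proof.
have [ce _] := be; apply: based_cone_lift => //=.
- by split => //; exact: continuous_cone_in.
- by have ct := @continuous_cone_pt R _ _ f; cont.
Qed.

End cone_pre.

(** Up to homotopy this is the twist along [f \o G], for [G] a homotopy from the
    identity to [e]. *)
Lemma heq_cone_pre_id A B (f : A -> B) (e : A -> A) : based_map f -> based_map e ->
  based_homotopic R e id -> based_heq R (@cone_pre _ _ _ f e).
Proof.
move=> bf be /homotopic_sym /homotopic_ext [G [cG G0 G1 Gp]].
have [cf fp] := bf.
pose H p := f (G p).
have cH : continuous H by rewrite /H; cont.
have H0 x r : r <= 0 -> H (x, r) = f x by move=> r0; rewrite /H G0.
have H1 x r : 1 <= r -> H (x, r) = (f \o e) x by move=> r0; rewrite /H G1.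
have Hp r : H (point, r) = point by rewrite /H Gp.
have H11 x : H (x, 1) = (f \o e) x by rewrite H1.
have bfe := based_map_comp be bf.
apply: (heq_homotopic (f := twist f H (f \o e))); first exact: based_cone_pre.
  have ct := @continuous_cone_pt R _ _ f.
  (* in the square of the points of height [r] over [G (x, s)], a linear
     interpolation between the edges [s = 0] and [r = 1], run through by the twist,
     and the edge [s = 1], run through by the map that [e] induces *)
  apply: (@homotopic_cone _ _ _ _ (f \o e) _ _ (fun p => cone_in R f p.1) (fun p =>
    cone_pt f (G (p.1.1, p.2 + (1 - p.2) * clamp (2 * p.1.2 - 1)),
      (1 - p.2) * clamp (2 * p.1.2) + p.2 * p.1.2))) => /=.
  - by have cin := @continuous_cone_in R _ _ f; cont.
  - by cont.
  - move=> x t; have -> : clamp (2 * 1 - 1) = 1 :> R by rewrite clamp_ge1 //; lra.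
    have -> : clamp (2 * 1) = 1 :> R by rewrite clamp_ge1 //; lra.
    by rewrite cone_pt1 ?G1 //; lra.
  - by move=> x t; rewrite cone_pt0 // mulr0 clamp0 !mulr0 addr0.
  - by move=> r t _ _; rewrite Gp cone_ptb.
  - by [].
  - by move=> y; rewrite twist_in.
  - by move=> y; rewrite cone_pre_in.
  - move=> x r r0 r1; rewrite twist_pt // mul0r addr0 subr0 mul1r add0r mul1r.
    have [h|h] := leP (r * 2) 1.
      rewrite twist_path_pt // G0; last by rewrite clamp_le0 //; lra.
      by rewrite mulrC clamp_id //; lra.
    rewrite (_ : r * 2 = 1 + (2 * r - 1)); last by ring.
    rewrite twist_path_in //; last by lra.
    have -> : clamp (2 * r) = 1 :> R by rewrite clamp_ge1 //; lra.
    have -> : clamp (2 * r - 1) = 2 * r - 1 :> R by rewrite clamp_id //; lra.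
    by rewrite cone_pt1.
  - by move=> x r r0 r1; rewrite cone_pre_pt // subrr !mul0r addr0 add0r mul1r G1.
exact: heq_twist.
Qed.

Lemma cone_pre_comp A'' A' A B (f : A -> B) (e : A' -> A) (g : A'' -> A') :
    based_map f -> based_map e -> based_map g ->
  @cone_pre _ _ _ f e \o @cone_pre _ _ _ (f \o e) g = @cone_pre _ _ _ f (e \o g).
Proof.
move=> bf be bg; have beg := based_map_comp bg be; have bfe := based_map_comp be bf.
apply/funext; elim/(@cone_ind R A'' B (f \o e \o g)) => [y|x r _ _ _] /=.
  by rewrite !cone_pre_in.
by rewrite cone_pre_pt // cone_pre_pt // [RHS](@cone_pre_pt _ _ _ f (e \o g)).
Qed.

(** With [g] inverse to [e], both [e \o g] and [g \o e] induce homotopy equivalences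
    of cones by the previous lemma, hence so do [e] and [g]. *)
Lemma same_htype_cone_source A' A B (f : A -> B) (e : A' -> A) :
    based_map f -> based_heq R e ->
  same_htype R (mapping_cone R (f \o e)) (mapping_cone R f).
Proof.
move=> bf [be [g [bg ge eg]]].
exists (@cone_pre _ _ _ f e); have bfe := based_map_comp be bf.
have [] := @heq_2of6 R _ _ _ _ (@cone_pre _ _ _ (f \o e \o g) e)
  (@cone_pre _ _ _ (f \o e) g) (@cone_pre _ _ _ f e); last by [].
- exact: based_cone_pre.
- exact: based_cone_pre.
- by apply: based_cone_pre => //; exact: based_map_comp.
- by rewrite cone_pre_comp //; apply: heq_cone_pre_id => //; exact: based_map_comp.
- by rewrite cone_pre_comp //; apply: heq_cone_pre_id => //; exact: based_map_comp.
Qed.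

Definition cone_post A B B' (e : B -> B') (f : A -> B) :
    mapping_cone R f -> mapping_cone R (e \o f) :=
  cone_lift (fun y => cone_in R (e \o f) (e y)) (cone_pt (e \o f)).

Section cone_post.
Context {A B B' : ptopologicalType} (e : B -> B') (f : A -> B).
Hypotheses (be : based_map e) (bf : based_map f).

Let post1 x : cone_pt (e \o f) (x, 1 : R) = cone_in R (e \o f) (e (f x)).
Proof. by rewrite cone_pt1. Qed.
Let post0 x : cone_pt (e \o f) (x, 0 : R) = cone_in R (e \o f) (e point).
Proof. by case: be => _ ->; rewrite cone_pt0. Qed.
Let postb (r : R) : 0 <= r -> r <= 1 ->
  cone_pt (e \o f) (point, r) = cone_in R (e \o f) (e point).
Proof. by case: bf be => [_ fp] [_ ep]; rewrite cone_ptb /= ?fp ep. Qed.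

Lemma cone_post_in y : cone_post e (cone_in R f y) = cone_in R (e \o f) (e y).
Proof. exact: cone_lift_in. Qed.

Lemma cone_post_pt x r : cone_post e (cone_pt f (x, r)) = cone_pt (e \o f) (x, r).
Proof. by rewrite /cone_post cone_lift_pt // cone_pt_clamp. Qed.

Lemma based_cone_post : based_map (@cone_post _ _ _ e f).
Proof.
have [ce ep] := be; apply: based_cone_lift => //=.
- split; last by rewrite ep.
  by have cin := @continuous_cone_in R _ _ (e \o f); cont.
- exact: continuous_cone_pt.
- by move=> x; rewrite cone_pt0.
- by move=> r r0 r1; rewrite postb // ep.
Qed.

End cone_post.

(** Up to homotopy this is the twist along [G \o f]: at time [t], the base is moved
    by [G] and the cylinder follows the part of length [1 + t] of [twist_path]. *)
Lemma heq_cone_post_id A B (e : B -> B) (f : A -> B) : based_map f -> based_map e ->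
  based_homotopic R e id -> based_heq R (@cone_post _ _ _ e f).
Proof.
move=> bf be /homotopic_ext [G [cG G0 G1 Gp]].
have [cf fp] := bf; have [_ ep] := be.
pose H (p : A * R) := G (f p.1, p.2).
have cH : continuous H by rewrite /H; cont.
have H0 x r : r <= 0 -> H (x, r) = (e \o f) x by move=> r0; rewrite /H G0.
have H1 x r : 1 <= r -> H (x, r) = f x by move=> r0; rewrite /H G1.
have Hp r : H (point, r) = point by rewrite /H /= fp Gp.
have H11 x : H (x, 1) = f x by rewrite H1.
have bfe := based_map_comp bf be.
apply: (heq_homotopic (f := twist (e \o f) H f)); first exact: based_cone_post.
  have ct := @continuous_cone_pt R _ _ (e \o f).
  have ctp := continuous_twist_path cH H0.
  apply: homotopic_sym.
  apply: (@homotopic_cone _ _ _ _ f _ _ (fun p => cone_in R (e \o f) (G p)) (fun p =>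
    twist_path (e \o f) H (p.1.1, p.1.2 * (1 + clamp p.2)))) => /=.
  - by have cin := @continuous_cone_in R _ _ (e \o f); cont.
  - by cont.
  - move=> x t; rewrite mul1r twist_path_in // ?clamp_ge0 // /H /=.
    have [t0|t0] := leP t 0; first by rewrite clamp_le0 // !G0.
    have [t1|t1] := leP 1 t; first by rewrite clamp_ge1 // !G1.
    by rewrite clamp_id // ltW.
  - by move=> x t; rewrite twist_path0 // mul0r.
  - by move=> r t _ _; rewrite twist_pathb.
  - by move=> t; rewrite Gp.
  - by move=> y; rewrite cone_post_in // G0.
  - by move=> y; rewrite twist_in // G1.
  - move=> x r r0 r1; rewrite cone_post_pt // clamp0 addr0 mulr1.
    by rewrite twist_path_pt.
  - by move=> x r r0 r1; rewrite clamp1 twist_pt.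
exact: heq_twist.
Qed.

Lemma cone_post_comp A B B' B'' (f : A -> B) (e : B -> B') (g : B' -> B'') :
    based_map f -> based_map e -> based_map g ->
  @cone_post _ _ _ g (e \o f) \o @cone_post _ _ _ e f = @cone_post _ _ _ (g \o e) f.
Proof.
move=> bf be bg; have bge := based_map_comp be bg; have bef := based_map_comp bf be.
apply/funext; elim/(@cone_ind R A B f) => [y|x r _ _ _] /=.
  by rewrite !cone_post_in.
by rewrite !cone_post_pt.
Qed.

Lemma same_htype_cone_target A B B' (f : A -> B) (e : B -> B') :
    based_map f -> based_heq R e ->
  same_htype R (mapping_cone R f) (mapping_cone R (e \o f)).
Proof.
move=> bf [be [g [bg ge eg]]].
exists (@cone_post _ _ _ e f); have bef := based_map_comp bf be.
have [] := @heq_2of6 R _ _ _ _ (@cone_post _ _ _ e f)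
  (@cone_post _ _ _ g (e \o f)) (@cone_post _ _ _ e (g \o (e \o f))); last by [].
- by apply: based_cone_post => //; exact: based_map_comp.
- exact: based_cone_post.
- exact: based_cone_post.
- by rewrite cone_post_comp //; apply: heq_cone_post_id => //; exact: based_map_comp.
- by rewrite cone_post_comp //; apply: heq_cone_post_id => //; exact: based_map_comp.
Qed.

Lemma same_htype_cone_contractible A B (f : A -> B) : based_map f ->
  same_htype R A one_point -> same_htype R B (mapping_cone R f).
Proof.
move=> bf /same_htype_sym [e he]; have [be _] := he.
apply: same_htype_trans (same_htype_cone_source bf he).
set f' := f \o e; have bf' : based_map f' by exact: based_map_comp.
have fp x r : cone_pt f' (x, r) = point :> mapping_cone R f'.
  by case: x; rewrite cone_ptb //; case: bf'.
have bin : based_map (cone_in R f') by split => //; exact: continuous_cone_in.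
pose k := cone_lift (@id B) (fun _ => point) : mapping_cone R f' -> B.
have f'p x : point = id (f' x) by case: x; case: bf'.
have bk : based_map k.
  by apply: based_cone_lift => //; [exact: based_map_id|exact: cont_cst].
exists (cone_in R f'); split => //; exists k; split => //.
  rewrite (_ : _ \o _ = id); first by apply: homotopic_refl; exact: based_map_id.
  by apply/funext => y /=; rewrite /k cone_lift_in.
rewrite (_ : _ \o _ = id); first by apply: homotopic_refl; exact: based_map_id.
apply/funext; elim/(@cone_ind R _ B f') => [y|x r _ _ _] /=.
  by rewrite /k cone_lift_in.
by rewrite /k cone_lift_pt // fp.
Qed.

End cone_functoriality.

(** * The cone of a composite *)

Section composite.
Context {R : realType} {L A B : ptopologicalType} (a : L -> A) (b : A -> B).
Hypotheses (ba : based_map a) (bb : based_map b).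
Let bba : based_map (b \o a) := based_map_comp ba bb.
Local Notation c := (@cone_post R _ _ _ b a).
Local Notation D := (mapping_cone R c).

Let bc : based_map c := based_cone_post bb ba.
Let fa : a point = point := proj2 ba.
Let fb : b point = point := proj2 bb.
Let ca := proj1 ba.
Let cb := proj1 bb.
Let cp : c point = point := proj2 bc.

Let psiB (p : A * R) := cone_pt b p.
Let psiH (p : (L * R) * R) := cone_pt b (a p.1.1, Num.min (clamp p.2) p.1.2).

Let psi1 l s : psiH ((l, 1), s) = psiB (a l, s).
Proof. by rewrite /psiH /psiB /= min_l ?clamp_le1 // cone_pt_clamp. Qed.
Let psi0 l s : psiH ((l, 0), s) = psiB (point, s).
Proof. by rewrite /psiH /psiB /= min_r ?clamp_ge0 // cone_pt0 // cone_ptb. Qed.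
Let psib r s : 0 <= r -> r <= 1 -> psiH ((point, r), s) = psiB (point, s).
Proof. by move=> _ _; rewrite /psiH /psiB /= fa !cone_ptb. Qed.

Let psi (p : mapping_cone R a * R) : mapping_cone R b :=
  cone_lift (fun x => psiB (x, p.2)) (fun q => psiH (q, p.2)) p.1.

Let psi_in x s : psi (cone_in R a x, s) = cone_pt b (x, s).
Proof. by rewrite /psi cone_lift_in // => *; rewrite psib. Qed.
Let psi_pt l t s : psi (cone_pt a (l, t), s) =
  cone_pt b (a l, Num.min (clamp s) (clamp t)).
Proof. by rewrite /psi cone_lift_pt // => *; rewrite psib. Qed.

Let continuous_psi : continuous psi.
Proof.
have ct := @continuous_cone_pt R _ _ b.
apply: cone_lift_cont2 => //; try first [exact: locally_compactR|exact: Rhausdorff].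
by rewrite /psiH; cont.
Qed.

Let psiT z : psi (z, 1) = cone_pre (c z).
Proof.
elim/(@cone_ind R L A a): z => [x|l t _ t0 t1].
  by rewrite psi_in cone_post_in // cone_pre_in // cone_pt1.
rewrite psi_pt cone_post_pt // cone_pre_pt // clamp1 min_r ?clamp_le1 //.
by rewrite cone_pt_clamp.
Qed.

Let psi_0 z : psi (z, 0) = point.
Proof.
elim/(@cone_ind R L A a): z => [x|l t _ t0 t1].
  by rewrite psi_in cone_pt0.
by rewrite psi_pt clamp0 min_l ?clamp_ge0 // cone_pt0.
Qed.

Let psi_b s : psi (point, s) = point.
Proof. by rewrite psi_in cone_ptb. Qed.

Let Phi : D -> mapping_cone R b := cone_lift (@cone_pre R _ _ _ b a) psi.

Let Phi_in w : Phi (cone_in R c w) = cone_pre w.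
Proof.
rewrite /Phi cone_lift_in // => *; rewrite ?psi_0 ?psi_b /=;
  by case: (based_cone_pre bb ba (R := R)).
Qed.
Let Phi_pt z s : Phi (cone_pt c (z, s)) = psi (z, clamp s).
Proof.
rewrite /Phi cone_lift_pt // => *; rewrite ?psi_0 ?psi_b /=;
  by case: (based_cone_pre bb ba (R := R)).
Qed.

Let based_Phi : based_map Phi.
Proof. by apply: based_cone_lift => //; exact: based_cone_pre. Qed.

Let PsiH (p : A * R) : D := cone_pt c (cone_in R a p.1, p.2).
Let Psi : mapping_cone R b -> D :=
  cone_lift (fun y => cone_in R c (cone_in R (b \o a) y)) PsiH.

Let Psi1 x : PsiH (x, 1) = cone_in R c (cone_in R (b \o a) (b x)).
Proof. by rewrite /PsiH /= cone_pt1 // cone_post_in. Qed.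
Let Psi0 x : PsiH (x, 0) = cone_in R c (cone_in R (b \o a) point).
Proof. by rewrite /PsiH /= cone_pt0. Qed.
Let Psib r : 0 <= r -> r <= 1 -> PsiH (point, r) = cone_in R c (cone_in R (b \o a) point).
Proof. by move=> _ _; rewrite /PsiH /= cone_ptb. Qed.

Let Psi_in y : Psi (cone_in R b y) = cone_in R c (cone_in R (b \o a) y).
Proof. exact: cone_lift_in. Qed.
Let Psi_pt x r : Psi (cone_pt b (x, r)) = cone_pt c (cone_in R a x, r).
Proof. by rewrite /Psi cone_lift_pt // /PsiH /= cone_pt_clamp. Qed.

Let based_Psi : based_map Psi.
Proof.
have cin := @continuous_cone_in R _ _ a; have ct := @continuous_cone_pt R _ _ c.
have cin' := @continuous_cone_in R _ _ c; have cin'' := @continuous_cone_in R _ _ (b \o a).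
apply: based_cone_lift => //; first by split => //; cont.
by rewrite /PsiH; cont.
Qed.

(* The square [t, s] of a double cone is contracted onto its edge [t = 1]:
   during the first half [s] shrinks to [min s t], during the second half [t]
   grows to 1; both edges [t = 0] and [s = 0] stay at the base point. *)
Let sq_s (t s o : R) : R := Num.min (clamp s) (Num.max t (1 - 2 * clamp o)).
Let sq_t (t o : R) : R := Num.max t (2 * clamp o - 1).

Let sq_s1 s o : sq_s 1 s o = clamp s.
Proof.
have := clamp_ge0 o; have := clamp_le1 s => h0 h1.
by rewrite /sq_s min_l // le_max h0.
Qed.
Let sq_t1 o : sq_t 1 o = 1.
Proof. by have := clamp_le1 o => h; rewrite /sq_t max_l //; lra. Qed.

Let hH (p : (L * R) * (R * R)) : D :=
  cone_pt c (cone_pt a (p.1.1, sq_t p.1.2 p.2.2), sq_s p.1.2 p.2.1 p.2.2).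
Let hB (p : A * (R * R)) : D := cone_pt c (cone_in R a p.1, p.2.1).

Let h1 l t : hH ((l, 1), t) = hB (a l, t).
Proof. by rewrite /hH /hB /= sq_s1 sq_t1 cone_pt_clamp (@cone_pt1 _ _ _ a). Qed.
Let hH0 l t : hH ((l, 0), t) = point.
Proof.
rewrite /hH /=; have [le1|gt1] := leP (2 * clamp t.2) 1.
  by rewrite (@cone_pt0 _ _ _ a) ?cone_ptb // /sq_t max_l //; lra.
rewrite cone_pt0 // /sq_s max_l; last by lra.
by rewrite min_r ?clamp_ge0.
Qed.
Let hBp t : hB (point, t) = point.
Proof. by rewrite /hB /= cone_ptb. Qed.
Let hHp r t : hH ((point, r), t) = point.
Proof. by rewrite /hH /= cone_ptb // cone_ptb. Qed.
Let h0 l t : hH ((l, 0), t) = hB (point, t).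
Proof. by rewrite hBp hH0. Qed.
Let hb r t : 0 <= r -> r <= 1 -> hH ((point, r), t) = hB (point, t).
Proof. by rewrite hBp hHp. Qed.

Let h (p : (mapping_cone R a * (R * R))) : D :=
  cone_lift (fun x => hB (x, p.2)) (fun q => hH (q, p.2)) p.1.

Let continuous_hH : continuous hH.
Proof.
have ct := @continuous_cone_pt R _ _ a; have ct' := @continuous_cone_pt R _ _ c.
by rewrite /hH /sq_s /sq_t; cont.
Qed.

Let continuous_h : continuous h.
Proof.
have cin := @continuous_cone_in R _ _ a.
have ct := @continuous_cone_pt R _ _ c.
apply: cone_lift_cont2 => //.
- by apply: locally_compact_prod; exact: locally_compactR.
- by rewrite /hB; cont.
Qed.

Let h_in x t : h (cone_in R a x, t) = hB (x, t).
Proof. by rewrite /h cone_lift_in // => *; rewrite hb. Qed.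
Let h_pt l r t : h (cone_pt a (l, r), t) = hH ((l, clamp r), t).
Proof. by rewrite /h cone_lift_pt // => *; rewrite hb. Qed.

Let uH (p : (L * R) * R) : D := hH (p.1, (1, p.2)).
Let uB (p : B * R) : D := cone_in R c (cone_in R (b \o a) p.1).
Let u1 l t : uH ((l, 1), t) = uB ((b \o a) l, t).
Proof. by rewrite /uH h1 /hB /= cone_pt1 // cone_post_in. Qed.
Let u0 l t : uH ((l, 0), t) = uB (point, t).
Proof. by rewrite /uH hH0. Qed.
Let ub r t : 0 <= r -> r <= 1 -> uH ((point, r), t) = uB (point, t).
Proof. by rewrite /uH hHp. Qed.

Let u (p : mapping_cone R (b \o a) * R) : D :=
  cone_lift (fun y => uB (y, p.2)) (fun q => uH (q, p.2)) p.1.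

Let continuous_u : continuous u.
Proof.
have cin := @continuous_cone_in R _ _ (b \o a).
have cin' := @continuous_cone_in R _ _ c.
apply: cone_lift_cont2 => //; try first [exact: locally_compactR|exact: Rhausdorff].
  by rewrite /uB; cont.
by rewrite /uH; cont.
Qed.

Let u_in y t : u (cone_in R (b \o a) y, t) = uB (y, t).
Proof. by rewrite /u cone_lift_in // => *; rewrite ub. Qed.
Let u_pt l r t : u (cone_pt (b \o a) (l, r), t) = uH ((l, clamp r), t).
Proof. by rewrite /u cone_lift_pt // => *; rewrite ub. Qed.

(** The cone [D] of the map of cones induced by [b] contains the cone of [b] as the
    union of [B] and of the cone over [A].  The rest of [D] is a double cone over
    [L], made of squares that are deformed onto one of their edges, which lies in
    the cone over [A]. *)
Lemma same_htype_cone_composite :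
  same_htype R (mapping_cone R b) (mapping_cone R (@cone_post R _ _ _ b a)).
Proof.
exists Psi; split => //; exists Phi; split => //.
  rewrite (_ : _ \o _ = id); first by apply: homotopic_refl; exact: based_map_id.
  apply/funext; elim/(@cone_ind R A B b) => [y|x r _ _ _] /=.
    by rewrite Psi_in Phi_in cone_pre_in.
  by rewrite Psi_pt Phi_pt psi_in cone_pt_clamp.
apply: homotopic_sym.
apply: (@homotopic_cone _ _ _ _ c _ _ u (fun p => h (p.1.1, (p.1.2, p.2)))) => //=.
- by cont.
- move=> z t; elim/(@cone_ind R L A a): z => [x|l r _ r0 r1].
    by rewrite h_in cone_post_in // u_in /hB /uB /= cone_pt1 // cone_post_in.
  by rewrite h_pt cone_post_pt // u_pt.
- move=> z t; elim/(@cone_ind R L A a): z => [x|l r _ r0 r1].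
    by rewrite h_in /hB /= cone_pt0.
  rewrite h_pt /hH /= cone_pt0 // /sq_s clamp0 min_l //.
  by rewrite le_max clamp_ge0.
- by move=> r t _ _; rewrite h_in hBp.
- by move=> t; rewrite u_in.
- move=> z; elim/(@cone_ind R L B (b \o a)): z => [y|l r _ r0 r1]; first by rewrite u_in.
  rewrite u_pt /uH /hH /= clamp_id ?ltW // /sq_t /sq_s clamp0 mulr0 sub0r subr0.
  have -> : Num.max r (-1) = r by rewrite max_l //; lra.
  have -> : Num.max r 1 = 1 by rewrite max_r //; lra.
  by rewrite clamp1 minxx (@cone_pt1 _ _ _ c) // cone_post_pt.
- move=> z; elim/(@cone_ind R L B (b \o a)): z => [y|l r _ r0 r1].
    by rewrite u_in Phi_in cone_pre_in // Psi_in.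
  rewrite u_pt Phi_in cone_pre_pt // Psi_pt /uH /hH /= clamp_id ?ltW //.
  rewrite /sq_t /sq_s clamp1.
  have -> : Num.max r (1 - 2 * 1) = r by rewrite max_l //; lra.
  have -> : Num.max r (2 * 1 - 1) = 1 by rewrite max_r //; lra.
  by rewrite min_r ?(@cone_pt1 _ _ _ a) // ltW.
- move=> z s s0 s1; elim/(@cone_ind R L A a): z => [x|l r _ r0 r1].
    by rewrite h_in.
  rewrite h_pt /hH /= clamp_id ?ltW // /sq_t /sq_s clamp0 mulr0 sub0r subr0.
  rewrite max_l; last by lra.
  rewrite max_r; last by lra.
  by rewrite min_l ?clamp_le1 // cone_pt_clamp.
- move=> z s s0 s1; rewrite Phi_pt clamp_id //.
  elim/(@cone_ind R L A a): z => [x|l r _ r0 r1].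
    by rewrite psi_in h_in Psi_pt.
  rewrite psi_pt h_pt Psi_pt /hH /= /sq_t /sq_s !clamp1 !clamp_id ?s0 ?s1 ?ltW //.
  have -> : Num.max r (1 - 2 * 1) = r by rewrite max_l //; lra.
  have -> : Num.max r (2 * 1 - 1) = 1 by rewrite max_r //; lra.
  by rewrite (@cone_pt1 _ _ _ a).
Qed.

End composite.

(** * Compactness and Lipschitz maps of row vectors *)

Section compactness.

Lemma closed_projection (X Y : topologicalType) (D : set Y) (Z : set (X * Y)) :
  compact D -> closed Z -> closed [set x | exists2 y, D y & Z (x, y)].
Proof.
move=> cD cZ; rewrite -openC openE => x /= nx; rewrite /interior.
move/compact_near_coveringP/near_covering_withinP : cD => cD.
have : \forall a \near x, D `<=` (fun y => ~ Z (a, y)).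
  apply: (cD _ (nbhs x) (fun a y => ~ Z (a, y))) => y Dy.
  have : nbhs (x, y) (~` Z).
    by apply: open_nbhs_nbhs; split; [exact: closed_openC|move=> h; apply: nx; exists y].
  move=> [[P Q] [/= nP nQ] PQ]; exists (Q, P) => // -[b a] /= [Qb Pa] _.
  exact: (PQ (a, b)).
by apply: filterS => a h [y Dy]; exact: h.
Qed.

(** Continuity of [k] on the closed set [B], in a form that glues along finite
    closed covers. *)
Definition cont_on {X Y : topologicalType} (B : set X) (k : X -> Y) :=
  forall A, closed A -> closed (B `&` k @^-1` A).

Lemma cont_on_glue (X Y : topologicalType) (B C : set X) (k : X -> Y) :
  (forall x, B x \/ C x) -> cont_on B k -> cont_on C k -> continuous k.
Proof.
move=> BC kB kC; apply/continuous_closedP => A clA.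
rewrite (_ : _ @^-1` _ = (B `&` k @^-1` A) `|` (C `&` k @^-1` A)).
  by apply: closedU; [exact: kB|exact: kC].
apply/seteqP; split => [x kx|x [[]|[]]//].
by case: (BC x); [left|right].
Qed.

Lemma cont_on_eq (X Y : topologicalType) (B : set X) (k l : X -> Y) :
  closed B -> continuous l -> (forall x, B x -> k x = l x) -> cont_on B k.
Proof.
move=> clB cl kl A clA; rewrite (_ : _ `&` _ = B `&` l @^-1` A).
  by apply: closedI => //; move/continuous_closedP: cl; exact.
by apply/seteqP; split => x [Bx] /= h; split => //=; [rewrite -kl|rewrite kl].
Qed.

Lemma closed_equalizer (X T : topologicalType) (f g : X -> T) :
    hausdorff_space T -> continuous f -> continuous g ->
  closed [set x | f x = g x].
Proof.
move=> hT cf cg; rewrite -openC openE => x /= /eqP fg; rewrite /interior.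
move: hT; rewrite open_hausdorff => /(_ _ _ fg)[[A B] /= [/set_mem Af /set_mem Bg] [oA oB /eqP AB]].
have nA : nbhs x (f @^-1` A) by apply: cf; exact: open_nbhs_nbhs.
have nB : nbhs x (g @^-1` B) by apply: cg; exact: open_nbhs_nbhs.
apply: filterS (filterI nA nB) => y [/= Ay By] fgy.
have : (A `&` B) (f y) by split => //; rewrite fgy.
by rewrite AB.
Qed.

Lemma compact_pos_lower (R : realType) (X : topologicalType) (D : set X) (f : X -> R) :
    compact D -> continuous f -> (forall x, D x -> 0 < f x) ->
  exists2 d, 0 < d & forall x, D x -> d <= f x.
Proof.
move=> cD cf f0; have [->|/set0P D0] := eqVneq D set0; first by exists 1.
have cNf : {within D, continuous (fun x => - f x)}.
  by apply: continuous_subspaceT; cont.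
have [c /set_mem Dc cmax] := compact_EVT_max D0 cD cNf.
exists (f c); first exact: f0.
by move=> x /mem_set/cmax; rewrite lerN2.
Qed.

End compactness.

Section vectors.
Context {R : realType}.

Lemma norm_row_le n (v : 'rV[R]_n) r : 0 <= r ->
  (`|v| <= r) <-> (forall i, `|v 0 i| <= r).
Proof.
move=> r0; rewrite [`|v|]mx_normrE; split => [h i|h].
  exact: le_trans (le_bigmax _ (fun ij => `|v ij.1 ij.2|) (0, i)) h.
by apply: bigmax_le => // -[i j] _; rewrite ord1.
Qed.

Lemma norm_row_lt n (v : 'rV[R]_n) r : 0 < r ->
  (`|v| < r) <-> (forall i, `|v 0 i| < r).
Proof.
move=> r0; rewrite [`|v|]mx_normrE; split => [h i|h].
  exact: le_lt_trans (le_bigmax _ (fun ij => `|v ij.1 ij.2|) (0, i)) h.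
by apply: bigmax_lt => // -[i j] _; rewrite ord1.
Qed.

Lemma cubeE n (v : 'rV[R]_n) : cube R n v <-> `|v| <= 1.
Proof. by rewrite norm_row_le. Qed.

Lemma open_cubeE n (v : 'rV[R]_n) : open_cube R n v <-> `|v| < 1.
Proof. by rewrite norm_row_lt. Qed.

Definition ballc n (r : R) : set 'rV[R]_n := [set v | `|v| <= r].

Lemma closed_ballc n r : closed (@ballc n r).
Proof.
apply: (@preimage_closed _ _ (fun v : 'rV[R]_n => `|v|) [set x | x <= r]).
  by move=> v _; exact: norm_continuous.
exact: closed_le.
Qed.

Lemma compact_ballc n r : compact (@ballc n r).
Proof.
apply: bounded_closed_compact; last exact: closed_ballc.
by exists r; split; [exact: num_real|move=> M rM v /= vr; exact: le_trans vr (ltW rM)].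
Qed.

(** The radial retraction onto the cube. *)
Definition retr n (v : 'rV[R]_n) : 'rV[R]_n := (Num.max 1 `|v|)^-1 *: v.

Lemma max1_gt0 (r : R) : 0 < Num.max 1 r.
Proof. by rewrite lt_max ltr01. Qed.

Lemma cont_retr (T : topologicalType) n (f : T -> 'rV[R]_n) :
  continuous f -> continuous (fun x => retr (f x)).
Proof.
move=> cf; apply: cont_scale => //; apply: cont_inv; last by cont.
by move=> x; rewrite gt_eqF // max1_gt0.
Qed.

Lemma retr_id n (v : 'rV[R]_n) : `|v| <= 1 -> retr v = v.
Proof. by move=> v1; rewrite /retr max_l // invr1 scale1r. Qed.

Lemma norm_retr_le n (v : 'rV[R]_n) : `|retr v| <= 1.
Proof.
have m0 := max1_gt0 `|v|.
rewrite /retr normrZ ger0_norm ?invr_ge0 ?(ltW m0) //.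
by rewrite mulrC ler_pdivrMr // mul1r le_max lexx orbT.
Qed.

Lemma retrK n (v : 'rV[R]_n) : retr (retr v) = retr v.
Proof. by rewrite retr_id // norm_retr_le. Qed.

(** The approximation is the inf-convolution of [g] on the cube with a large
    multiple of the distance. *)
Lemma lipschitz_approx1 n (g : 'rV[R]_n -> R) (e : R) : continuous g -> 0 < e ->
  exists (u : 'rV[R]_n -> R) (L : R), [/\ 0 <= L,
    forall v v', u v <= u v' + L * `|v - v'| &
    forall v, `|v| <= 1 -> `|u v - g v| <= e].
Proof.
move=> cg e0.
(* [d] is a modulus of uniform continuity of [g] for [e] *)
have [d d0 dP] : exists2 d, 0 < d & forall p : 'rV[R]_n * 'rV[R]_n,
    (ballc 1 `*` ballc 1) p -> d <= `|p.1 - p.2| + Num.max 0 (e - (g p.1 - g p.2)).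
  apply: compact_pos_lower.
  - by apply: compact_setX; exact: compact_ballc.
  - by cont.
  - move=> [v w] _ /=; have [->|vw] := eqVneq v w.
      by rewrite !subrr subr0 normr0 add0r lt_max e0 orbT.
    apply: ltr_wpDr; first by rewrite le_max lexx.
    by rewrite normr_gt0 subr_eq0.
have n1 (r : R) : 0 < 1 + `|r| by have := normr_ge0 r; lra.
have [b b0 bP] : exists2 b, 0 < b & forall v : 'rV[R]_n, ballc 1 v -> b <= (1 + `|g v|)^-1.
  apply: compact_pos_lower; first exact: compact_ballc.
    by apply: cont_inv; [move=> x; rewrite gt_eqF // n1|cont].
  by move=> v _; rewrite invr_gt0 n1.
have gB v : `|v| <= 1 -> `|g v| <= b^-1.
  move=> /bP; rewrite -[X in X <= _]invrK lef_pV2 ?posrE ?invr_gt0 ?n1 //.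
  by apply: le_trans; rewrite lerDr.
pose B := b^-1; have B0 : 0 < B by rewrite invr_gt0.
(* at distance [d] the penalty already exceeds the oscillation of [g] *)
pose L := 2 * B / d; have L0 : 0 <= L by rewrite divr_ge0 ?mulr_ge0 ?(ltW B0) ?(ltW d0).
pose E v := [set g w + L * `|v - w| | w in @ballc n 1].
have E0 v : E v !=set0 by exists (g 0 + L * `|v - 0|); exists 0 => //; rewrite /ballc /= normr0.
have Elb v : has_lbound (E v).
  exists (- B) => _ [w w1 <-]; have := gB w w1; rewrite ler_norml => /andP[h _].
  by apply: le_trans h _; rewrite lerDl mulr_ge0.
exists (fun v => inf (E v)), L; split => //.
  move=> v v'; rewrite -lerBlDr; apply: lb_le_inf => // _ [w w1 <-].
  rewrite lerBlDr; apply: le_trans (_ : g w + L * `|v - w| <= _).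
    by apply: ge_inf => //; exists w.
  rewrite -addrA lerD2l -mulrDr ler_wpM2l //.
  by rewrite (le_trans _ (ler_normD _ _)) // [v' - w + _]addrC addrA subrK.
move=> v v1; rewrite ler_distl; apply/andP; split; last first.
  apply: le_trans (_ : g v <= _); last by rewrite lerDl ltW.
  by apply: ge_inf => //; exists v => //; rewrite subrr normr0 mulr0 addr0.
apply: lb_le_inf => // _ [w w1 <-].
have [dvw|dvw] := ltP `|v - w| d.
  have /dP /= : (ballc 1 `*` ballc 1) (v, w) by [].
  have [h|h] := leP (e - (g v - g w)) 0; first by rewrite addr0 => /(lt_le_trans dvw); rewrite ltxx.
  move=> _; have := mulr_ge0 L0 (normr_ge0 (v - w)); lra.
have := gB v v1; have := gB w w1; rewrite !ler_norml => /andP[w2 _] /andP[_ v2].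
have : 2 * B <= L * `|v - w|.
  by rewrite /L mulrAC ler_pdivlMr // ler_pM2l // mulr_gt0.
move: v2 w2; rewrite -/B; lra.
Qed.

Lemma lipschitz_approx n m (g : 'rV[R]_n -> 'rV[R]_m) (e : R) : continuous g -> 0 < e ->
  exists (u : 'rV[R]_n -> 'rV[R]_m) (L : R), [/\ 0 <= L,
    forall v v', `|u v - u v'| <= L * `|v - v'| &
    forall v, `|v| <= 1 -> `|u v - g v| <= e].
Proof.
move=> cg e0.
have cgi i : continuous (fun v => g v 0 i).
  by apply: (@cont_comp _ _ _ (fun M : 'rV[R]_m => M 0 i)) => //; exact: coord_continuous.
pose X i := cid (lipschitz_approx1 (cgi i) e0).
pose U i := projT1 (X i); pose XL i := cid (projT2 (X i)); pose L i := projT1 (XL i).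
have UP i : [/\ 0 <= L i, forall v v', U i v <= U i v' + L i * `|v - v'| &
    forall v, `|v| <= 1 -> `|U i v - g v 0 i| <= e] := projT2 (XL i).
pose M := \sum_i L i.
have LM i : L i <= M.
  rewrite /M (bigD1 i) //= lerDl; apply: sumr_ge0 => k _; by case: (UP k).
have M0 : 0 <= M by apply: sumr_ge0 => k _; case: (UP k).
exists (fun v => \row_i U i v), M; split => //.
  move=> v v'; apply/norm_row_le; first by rewrite mulr_ge0.
  move=> i; rewrite !mxE; have [L0 UL _] := UP i.
  have h : L i * `|v - v'| <= M * `|v - v'| by rewrite ler_wpM2r.
  rewrite ler_distl; have := UL v v'; have := UL v' v; rewrite distrC.
  by move=> h1 h2; apply/andP; split; lra.
move=> v v1; apply/norm_row_le; first exact: ltW.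
by move=> i; rewrite !mxE; case: (UP i) => _ _; exact.
Qed.

Lemma continuous_lipschitz n m (u : 'rV[R]_n -> 'rV[R]_m) (L : R) : 0 <= L ->
  (forall v v', `|u v - u v'| <= L * `|v - v'|) -> continuous u.
Proof.
move=> L0 uL v A /nbhs_ballP [d /= d0 dA].
have L1 : 0 < L + 1 by rewrite ltr_wpDl.
apply/nbhs_ballP; exists (d / (L + 1)) => /= [|v']; first by rewrite divr_gt0.
rewrite -ball_normE /= ltr_pdivlMr // => h; apply: dA; rewrite -ball_normE /=.
apply: le_lt_trans (uL v v') _; apply: le_lt_trans h.
by rewrite mulrC ler_wpM2l // lerDl.
Qed.

(** A Lipschitz map of the [n]-dimensional cube into a space of larger dimension
    [m] misses a point near the origin: among the [M ^ m] points of a grid of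
    mesh [r / M], more than there are little cubes of edge [2 / (c * M)] in a
    subdivision of the source, two would be hit from the same little cube. *)
Lemma lipschitz_miss n m (u : 'rV[R]_n -> 'rV[R]_m) (L r : R) : (n < m)%N ->
    0 <= L -> (forall v v', `|u v - u v'| <= L * `|v - v'|) -> 0 < r ->
  exists2 p, `|p| <= r & forall v, `|v| <= 1 -> u v <> p.
Proof.
move=> nm L0 uL r0; apply: contrapT => np.
have hit p : exists v, `|p| <= r -> `|v| <= 1 /\ u v = p.
  have [pr|pr] := pselect (`|p| <= r); last by exists 0.
  apply: contrapT => nv; apply: np; exists p => // v v1 uv; apply: nv.
  by exists v.
have {hit} [s sP] := choice hit.
(* [c] makes the image of a little cube smaller than the mesh of the grid *)
pose c := (Num.trunc (2 * L / r)).+1.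
have cP : 2 * L < c%:R * r by rewrite -ltr_pdivrMr //; exact: truncnS_gt.
(* then [M ^ m >= M ^ n.+1 > (c.+1 * M) ^ n] *)
pose M := (c.+1 ^ n).+1; pose N := (c * M)%N.
have M0 : 0 < M%:R :> R by rewrite ltr0n.
have N0 : 0 < N%:R :> R by rewrite ltr0n muln_gt0.
pose p (j : {ffun 'I_m -> 'I_M}) : 'rV[R]_m := \row_i (r * (j i)%:R / M%:R).
have pr j : `|p j| <= r.
  apply/norm_row_le => [|i]; first exact: ltW.
  rewrite mxE ger0_norm; last by rewrite divr_ge0 ?mulr_ge0 // ltW.
  by rewrite ler_pdivrMr // ler_pM2l // ler_nat ltnW.
pose a (v : 'rV[R]_n) : {ffun 'I_n -> 'I_N.+1} :=
  [ffun i => inord (Num.trunc ((v 0 i + 1) / 2 * N%:R))].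
have aP v v' : `|v| <= 1 -> `|v'| <= 1 -> a v = a v' -> `|v - v'| * N%:R <= 2.
  move=> v1 v'1 avv'; rewrite -ler_pdivlMr //; apply/norm_row_le; first by rewrite divr_ge0 // ltW.
  move=> i; rewrite !mxE.
  have {avv'} := congr1 (fun f : {ffun 'I_n -> 'I_N.+1} => f i : nat) avv'.
  move: v1 v'1 => /(norm_row_le _ ler01)/(_ i) + /(norm_row_le _ ler01)/(_ i).
  rewrite !ffunE; move: (v 0 i) (v' 0 i) => x y.
  rewrite !ler_norml => /andP[x0 x1] /andP[y0 y1].
  have bd (z : R) : -1 <= z -> z <= 1 -> (Num.trunc ((z + 1) / 2 * N%:R) < N.+1)%N.
    move=> z0 z1; rewrite ltnS -(ler_nat R); apply: (le_trans (y := (z + 1) / 2 * N%:R)).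
      by rewrite truncn_le mulr_ge0 ?divr_ge0 ?(ltW N0) //; lra.
    by rewrite ler_piMl ?(ltW N0) //; lra.
  rewrite !inordK ?bd // => E.
  have tr (z : R) : -1 <= z -> (Num.trunc ((z + 1) / 2 * N%:R))%:R <= (z + 1) / 2 * N%:R
      < (Num.trunc ((z + 1) / 2 * N%:R))%:R + 1.
    move=> z0; rewrite natr1; apply: truncn_itv.
    by rewrite mulr_ge0 ?divr_ge0 ?(ltW N0) //; lra.
  have := tr x x0; have := tr y y0; rewrite E => /andP[h1 h2] /andP[h3 h4].
  rewrite -mulNr ler_pdivlMr // ler_pdivrMr //.
  by apply/andP; split; lra.
have inj : injective (fun j => a (s (p j))).
  move=> j j' /aP; have [s1 us] := sP _ (pr j); have [s1' us'] := sP _ (pr j').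
  move=> /(_ s1 s1') h; apply/ffunP => i; apply/eqP.
  have : `|p j - p j'| * N%:R <= L * 2.
    rewrite -us -us'; apply: le_trans (_ : L * `|s (p j) - s (p j')| * N%:R <= _).
      by rewrite ler_wpM2r // ltW.
    by rewrite -mulrA ler_wpM2l.
  have /(norm_row_le _ (normr_ge0 _))/(_ i) := lexx `|p j - p j'|.
  rewrite !mxE -mulrBl -mulrBr normrM (ger0_norm (x := M%:R^-1)) ?invr_ge0 ?(ltW M0) //.
  rewrite normrM (ger0_norm (ltW r0)) => h1 h2.
  have h3 : r * `|(j i)%:R - (j' i)%:R| * c%:R < c%:R * r.
    apply: le_lt_trans cP; rewrite [2 * L]mulrC; apply: le_trans h2.
    rewrite /N natrM mulrA [in X in _ <= X]mulrAC; apply: ler_wpM2r => //.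
    by rewrite -ler_pdivrMr.
  have : `|(j i)%:R - (j' i)%:R| < 1 :> R.
    by rewrite -(ltr_pM2l (x := c%:R * r)) ?mulr_gt0 ?ltr0n //; lra.
  rewrite ltr_norml => /andP[h4 h5]; have [jj|jj|jj] := ltngtP (j i) (j' i); last by rewrite -val_eqE /= jj.
    have : (j i).+1%:R <= (j' i)%:R :> R by rewrite ler_nat.
    by rewrite -natr1; lra.
  have : (j' i).+1%:R <= (j i)%:R :> R by rewrite ler_nat.
  by rewrite -natr1; lra.
have := leq_card _ inj; rewrite !card_ffun !card_ord leqNgt => /negP; apply.
apply: leq_trans (_ : M ^ n.+1 <= _)%N; last by rewrite leq_exp2l // ltnS expn_gt0.
apply: leq_ltn_trans (_ : (c.+1 * M) ^ n < _)%N.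
  have NM : (N.+1 <= c.+1 * M)%N by rewrite mulSn -add1n leq_add2r.
  by case: (posnP n) => [->//|n0]; rewrite leq_exp2r.
by rewrite expnMn expnS ltn_pmul2r ?expn_gt0.
Qed.

End vectors.

(** * Cells of a CW complex *)

Section cw_complex.
Context {R : realType} {K : ptopologicalType} {C : nat -> Type}.
Variable phi : forall n, C n -> 'rV[R]_n -> K.
Hypothesis cw : cw_structure phi.

(** A classical choice type, so that finite collections of cells are sequences. *)
Definition cell : choiceType := {classic {n & C n}}.
Definition dim (e : cell) : nat := projT1 e.

(** The characteristic map, made total and continuous by precomposition with the
    retraction onto the cube. *)
Definition chi (e : cell) (v : 'rV[R]_(dim e)) : K := phi (projT2 e) (retr v).
Arguments chi : clear implicits.

Lemma cw_hausdorff : hausdorff_space K. Proof. by case: cw. Qed.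

Lemma chi_retr e v : chi e (retr v) = chi e v.
Proof. by rewrite /chi retrK. Qed.

Lemma chi_phi e v : `|v| <= 1 -> chi e v = phi (projT2 e) v.
Proof. by move=> v1; rewrite /chi retr_id. Qed.

Lemma continuous_chi e : continuous (chi e).
Proof.
have [_ /(_ _ (projT2 e))[cphi _] _ _ _] := cw.
move=> v; rewrite /chi; apply: (@cvg_comp _ _ _ (@retr R (dim e)) (phi (projT2 e))
  (nbhs v) (within (cube R (dim e)) (nbhs (retr v)))); last first.
  have cv : cube R (dim e) (retr v) by apply/cubeE; exact: norm_retr_le.
  exact: (proj1 (subspace_continuousP _ _) cphi).
move=> A hA.
have h : nbhs v (@retr R (dim e) @^-1` [set w | cube R (dim e) w -> A w]).
  exact: (@cont_retr R _ _ id (@cont_id _) v _ hA).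
by apply: (filterS _ h) => w /= Aw; apply: Aw; apply/cubeE; exact: norm_retr_le.
Qed.

Lemma cell_existsP (y : K) : exists e : cell, exists2 v, `|v| < 1 & chi e v = y.
Proof.
have [_ _ /(_ y)[e [[v /open_cubeE v1 <-] _]] _ _] := cw.
by exists e; exists v => //; rewrite chi_phi // ltW.
Qed.

(** The cell and the coordinates of a point are kept in one dependent pair, so that
    equality of addresses makes sense before the cells are known to agree. *)
Definition addr (y : K) : {e : cell & 'rV[R]_(dim e)} :=
  existT (fun e => 'rV[R]_(dim e)) (projT1 (cid (cell_existsP y)))
    (projT1 (cid2 (projT2 (cid (cell_existsP y))))).

Definition cell_of (y : K) : cell := projT1 (addr y).
Definition coord (y : K) : 'rV[R]_(dim (cell_of y)) := projT2 (addr y).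

Lemma norm_coord y : `|coord y| < 1.
Proof. by rewrite /coord /=; case: cid2. Qed.

Lemma coordK y : chi (cell_of y) (coord y) = y.
Proof. by rewrite /coord /cell_of /=; case: cid2. Qed.

Lemma addr_chi e v : `|v| < 1 -> addr (chi e v) = existT (fun e => 'rV[R]_(dim e)) e v.
Proof.
move=> v1; set y := chi e v.
have w1 := norm_coord y; have wy := coordK y.
have [_ inj uniq _ _] := cw.
have E : cell_of y = e.
  have [e' [_ ue']] := uniq y.
  rewrite -(ue' (cell_of y)); last first.
    by exists (coord y); [apply/open_cubeE|rewrite -chi_phi // ltW].
  by apply: ue'; exists v; [apply/open_cubeE|rewrite -chi_phi // ltW].
move: w1 wy; rewrite /coord /cell_of in E *.
case: (addr y) E => e' w /= E; subst e' => w1 wy.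
congr existT; have [_ injv] := inj _ (projT2 e).
apply: injv; first by rewrite inE; apply/open_cubeE.
  by rewrite inE; apply/open_cubeE.
by rewrite -!chi_phi ?(ltW w1) ?(ltW v1).
Qed.

Lemma cell_of_chi e v : `|v| < 1 -> cell_of (chi e v) = e.
Proof. by move=> v1; rewrite /cell_of addr_chi. Qed.

Lemma bnd_existsP (e : cell) : exists s : seq cell,
  (forall e', e' \in s -> (dim e' < dim e)%N) /\
  forall v, `|v| = 1 -> cell_of (chi e v) \in s.
Proof.
have [_ _ _ /(_ _ (projT2 e))[E [finE Edim bE]] _] := cw.
have /(@finite_seqP cell) [s Es] := finE.
exists s; split => [e' e's|v v1]; first by apply: Edim; rewrite Es.
have [|e' Ee' [w /open_cubeE w1 wv]] := bE (chi e v).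
  exists v; last by rewrite chi_phi ?v1.
  by split; [apply/cubeE; rewrite v1|move/open_cubeE; rewrite v1 ltxx].
suff -> : cell_of (chi e v) = e' by move: Ee'; rewrite Es.
by rewrite -wv -(@chi_phi e') ?cell_of_chi // ltW.
Qed.

(** Some finite collection of cells of smaller dimension whose union contains the
    boundary of [e]; no minimality is claimed. *)
Definition bnd e : seq cell := projT1 (cid (bnd_existsP e)).

Lemma dim_bnd e e' : e' \in bnd e -> (dim e' < dim e)%N.
Proof. by rewrite /bnd; case: cid => s /= [+ _]; exact. Qed.

Lemma mem_bnd e v : `|v| = 1 -> cell_of (chi e v) \in bnd e.
Proof. by rewrite /bnd; case: cid => s /= [_ +]; exact. Qed.

Lemma mem_closed_cell e v : `|v| <= 1 -> cell_of (chi e v) \in e :: bnd e.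
Proof.
rewrite le_eqVlt inE => /orP[/eqP/mem_bnd ->|/cell_of_chi ->]; by rewrite ?eqxx ?orbT.
Qed.

Lemma dim_closed_cell e v : (dim (cell_of (chi e v)) <= dim e)%N.
Proof.
rewrite -chi_retr; have /mem_closed_cell := norm_retr_le v.
by rewrite inE => /predU1P[->//|/dim_bnd/ltnW].
Qed.

Definition cellwise {T : Type} (G : forall e, 'rV[R]_(dim e) -> T) (y : K) : T :=
  G (cell_of y) (coord y).

Lemma cellwiseE T (G : forall e, 'rV[R]_(dim e) -> T) e v :
  `|v| < 1 -> cellwise G (chi e v) = G e v.
Proof. by move=> v1; rewrite /cellwise /coord /cell_of addr_chi. Qed.

Lemma cw_closedP (A : set K) : (forall e, closed (chi e @^-1` A)) -> closed A.
Proof.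
move=> clA; have [_ _ _ _ weak] := cw; apply: weak => n c.
rewrite (_ : _ `&` _ = ballc 1 `&` chi (existT C n c : cell) @^-1` A).
  by apply: closedI; [exact: closed_ballc|exact: (clA (existT C n c))].
have chiE (v : 'rV[R]_n) : `|v| <= 1 -> chi (existT C n c) v = phi c v.
  exact: (@chi_phi (existT C n c)).
apply/seteqP; split => v [v1 Av].
  by have v1' := iffLR (cubeE v) v1; split => //=; rewrite chiE.
by split; [exact/cubeE|move: Av => /=; rewrite chiE].
Qed.

Lemma cw_continuousP (T : topologicalType) (g : K -> T) :
  (forall e, continuous (fun v => g (chi e v))) -> continuous g.
Proof.
move=> cg; apply/continuous_closedP => A clA; apply: cw_closedP => e.
by have /continuous_closedP := cg e; exact.
Qed.

Section cont_on_cells.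
Context {X T : topologicalType} (u : X -> K) (B : set X) (k : X -> T).
Hypotheses (cu : continuous u) (clB : closed B).

(** The points mapped by [u] into the image of a compact part [D] of a closed
    cell form a closed set, on which continuity may be checked on [D]. *)
Lemma cont_on_cell e (D : set 'rV[R]_(dim e)) (G : X * 'rV[R]_(dim e) -> T) :
    compact D -> continuous G ->
    (forall x w, B x -> D w -> chi e w = u x -> k x = G (x, w)) ->
  cont_on (B `&` [set x | exists2 w, D w & chi e w = u x]) k.
Proof.
move=> cD cG kG A clA.
rewrite (_ : _ `&` _ = B `&` [set x | exists2 w, D w &
    ([set p : X * 'rV[R]_(dim e) | chi e p.2 = u p.1] `&` G @^-1` A) (x, w)]).
  apply: closedI => //; apply: closed_projection => //.
  apply: closedI; last by have /continuous_closedP := cG; exact.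
  have cc := @continuous_chi e.
  by apply: closed_equalizer; [exact: cw_hausdorff|cont|cont].
apply/seteqP; split => x.
  move=> [[Bx [w Dw wu]] kx]; split => //; exists w => //; split => //=.
  by rewrite -(kG x w).
move=> [Bx [w Dw [/= wu Gw]]]; split; last by rewrite /= (kG x w).
by split => //; exists w.
Qed.

Lemma cont_on_cells (s : seq cell) (D : forall e, set 'rV[R]_(dim e))
    (G : forall e, X * 'rV[R]_(dim e) -> T) :
    (forall e, e \in s -> compact (D e)) ->
    (forall e, e \in s -> continuous (G e)) ->
    (forall e x w, e \in s -> B x -> D e w -> chi e w = u x -> k x = G e (x, w)) ->
    (forall x, B x -> exists2 e, e \in s & exists2 w, D e w & chi e w = u x) ->
  cont_on B k.
Proof.
move=> cD cG kG cov A clA.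
rewrite (_ : _ `&` _ = \bigcup_(e in [set` s])
    ((B `&` [set x | exists2 w, D e w & chi e w = u x]) `&` k @^-1` A)).
  apply: closed_bigcup; first exact: finite_seq.
  move=> e es; apply: (cont_on_cell (G := G e)) => //; [exact: cD|exact: cG|].
  by move=> x w Bx; exact: kG.
apply/seteqP; split => x; last by move=> [e _ [[]]].
by move=> [Bx kx]; have [e es ewu] := cov x Bx; exists e.
Qed.

End cont_on_cells.

Lemma cover_cells (X : Type) (u : X -> K) (s : seq cell) x : cell_of (u x) \in s ->
  exists2 e, e \in s & exists2 w, ballc 1 w & chi e w = u x.
Proof.
move=> us; exists (cell_of (u x)) => //; exists (coord (u x)); last exact: coordK.
exact/ltW/norm_coord.
Qed.

(** Points chosen in the distinct open cells met by [A] form a set all of whose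
    subsets are closed, as every closed cell contains finitely many of them. *)
Lemma compact_cells (A : set K) : compact A ->
  exists s : seq cell, forall x, A x -> cell_of x \in s.
Proof.
move=> cA; pose P := [set e | exists2 x, A x & cell_of x = e].
have pE e : exists x, P e -> A x /\ cell_of x = e.
  have [[x Ax xe]|nP] := pselect (P e); first by exists x.
  by exists (chi e 0).
have [p pP] := choice pE.
have clQ (Q : set cell) : Q `<=` P -> closed (p @` Q).
  move=> QP; apply: cw_closedP => e.
  rewrite (_ : _ @^-1` _ = chi e @^-1` (p @` (Q `&` [set` e :: bnd e]))); last first.
    apply/seteqP; split => v [e' Qe' pv]; last by exists e' => //; case: Qe'.
    exists e' => //; split => //=.
    have [_ <-] := pP e' (QP _ Qe'); rewrite pv -chi_retr.
    exact/mem_closed_cell/norm_retr_le.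
  have /continuous_closedP := @continuous_chi e; apply.
  move: cw_hausdorff => /hausdorff_accessible/accessible_finite_set_closed; apply.
  by apply: finite_image; apply: finite_setIr; exact: finite_seq.
have cA' : cover_compact A by rewrite -compact_cover.
have [] := cA' cell setT (fun e => ~` (p @` (P `\ e))).
- by move=> e _; apply/closed_openC/clQ => ? [].
- move=> x Ax; exists (cell_of x) => //= -[e [Pe ne] px]; apply: ne.
  by have [_ <-] := pP e Pe; rewrite px.
move=> D _ covD; have /finite_seqP [s Ds] := finite_fset D.
rewrite Ds in covD; exists s => x Ax.
have Px : P (cell_of x) by exists x.
have [Ap pc] := pP _ Px; have [d /= dD pd] := covD _ Ap.
have [<-//|ne] := eqVneq d (cell_of x).
by exfalso; apply: pd; exists (cell_of x) => //; split => //= h; move: ne; rewrite h eqxx.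
Qed.

Definition coord_in e (y : K) : option 'rV[R]_(dim e) :=
  if pselect (exists2 w, `|w| < 1 & chi e w = y) is left ex
  then Some (projT1 (cid2 ex)) else None.

Lemma coord_inE e w : `|w| < 1 -> coord_in e (chi e w) = Some w.
Proof.
move=> w1; rewrite /coord_in; case: pselect => [ex|[]]; last by exists w.
case: cid2 => w' /= w'1 ww'; congr Some.
have := addr_chi w'1; rewrite ww' addr_chi // => h; exact/esym/(existT_inj2 h).
Qed.

Lemma coord_inN e y : cell_of y <> e -> coord_in e y = None.
Proof.
move=> ye; rewrite /coord_in; case: pselect => // -[w w1 wy].
by case: ye; rewrite -wy cell_of_chi.
Qed.

Lemma cell_cases e y :
  (exists2 w, `|w| < 1 & y = chi e w) \/ (cell_of y <> e).
Proof.
have [E|] := pselect (cell_of y = e); [left|by right].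
by rewrite -E; exists (coord y); [exact: norm_coord|rewrite coordK].
Qed.

End cw_complex.
Arguments chi {R K C} phi e v.

(** * Pushing a map of the cube into the cells of its dimension *)

Section compression.
Context {R : realType} {M : ptopologicalType} {C : nat -> Type}.
Context {phi : forall n, C n -> 'rV[R]_n -> M} (cw : cw_structure phi).
Local Notation cell := (@cell C).
Local Notation chi := (chi phi).
Local Notation cell_of := (cell_of cw).
Local Notation coord_in := (coord_in phi).

Section top_cell.
Variables (e : cell) (s : seq cell).
Hypotheses (es : e \notin s) (se : forall e', e' \in s -> (dim e' <= dim e)%N).

Lemma boundary_not_top w : `|w| = 1 -> cell_of (chi e w) <> e.
Proof. by move=> /(mem_bnd cw) + h; rewrite h => /dim_bnd; rewrite ltnn. Qed.

Lemma other_not_top e' w : e' \in s -> `|w| <= 1 -> cell_of (chi e' w) <> e.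
Proof.
move=> e's /(mem_closed_cell cw) + h; rewrite h inE => /predU1P[ee'|/dim_bnd].
  by move: es; rewrite ee' e's.
by rewrite ltnNge se.
Qed.

(** For modifying [u] inside a cell [e] of largest dimension: the image of [u] is
    covered by closed cells, and those other than [e] do not meet the interior of
    [e]. *)
Lemma continuous_top_cell (X T : topologicalType) (u : X -> M) (k l : X -> T)
    (D : set 'rV[R]_(dim e)) (G : X * 'rV[R]_(dim e) -> T) :
    continuous u -> continuous l -> continuous G -> compact D ->
    (forall x, cell_of (u x) \in e :: s) ->
    (forall x w, D w -> chi e w = u x -> k x = G (x, w)) ->
    (forall x, cell_of (u x) <> e -> k x = l x) ->
    (forall x w, `|w| < 1 -> u x = chi e w -> D w) ->
  continuous k.
Proof.
move=> cu cl cG cD ues kG kl uD.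
pose B := \bigcup_(e' in [set` s]) [set x | exists2 w, ballc 1 w & chi e' w = u x].
have clB : closed B.
  apply: closed_bigcup; first exact: finite_seq.
  move=> e' _; apply: (@closed_projection _ _ _ [set p | chi e' p.2 = u p.1]).
    exact: compact_ballc.
  have cc := continuous_chi cw (e := e').
  by apply: closed_equalizer; [exact: cw_hausdorff cw|cont|cont].
apply: (cont_on_glue (B := setT `&` [set x | exists2 w, D w & chi e w = u x]) (C := B)).
- move=> x; have [[w w1 uw]|ue] := cell_cases cw e (u x).
    by left; split => //; exists w => //; apply: uD uw.
  have := ues x; rewrite inE => /predU1P[//|us]; right.
  by have [e' e's ew] := cover_cells us; exists e'.
- by apply: (cont_on_cell cw cu closedT cD cG) => x w _; exact: kG.
- apply: (cont_on_eq (l := l)) => // x [e' e's [w w1 wu]].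
  by apply: kl; rewrite -wu; exact: other_not_top.
Qed.

(** A map of a cube of dimension smaller than that of [e] is deformed off some
    point of [e], by making it Lipschitz, in the coordinates of [e], over the
    middle of this cell. *)
Lemma avoid_point n (h : 'rV[R]_n -> M) : (n < dim e)%N -> continuous h ->
    (forall v, h (retr v) = h v) -> (forall v, cell_of (h v) \in e :: s) ->
  exists k : 'rV[R]_n * R -> M, [/\ continuous k,
    forall v t, k (retr v, t) = k (v, t), forall v, k (v, 0) = h v,
    forall v t, cell_of (h v) <> e -> k (v, t) = h v &
    (forall v, cell_of (k (v, 1)) \in e :: s) /\
    exists2 p, `|p| < 1 & forall v, k (v, 1) <> chi e p].
Proof.
move=> ne ch hr hes.
(* the coordinates of [h v], damped to 0 near the boundary of [e] *)
pose W v : 'rV[R]_(dim e) :=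
  if coord_in e (h v) is Some w then clamp (2 - 2 * `|w|) *: w else 0.
have cW : continuous W.
  apply: (@continuous_top_cell _ _ h W (fun=> 0) (ballc 1)
    (fun p => clamp (2 - 2 * `|p.2|) *: p.2)) => //.
  - exact: cont_cst.
  - by cont.
  - exact: compact_ballc.
  - move=> v w; rewrite /ballc /= le_eqVlt => /orP[/eqP w1 wh|w1 wh].
      rewrite /W (coord_inN (cw := cw)); last by rewrite -wh; exact: boundary_not_top.
      by rewrite w1 mulr1 subrr clamp0 scale0r.
    by rewrite /W -wh (coord_inE cw).
  - by move=> v ve; rewrite /W (coord_inN (cw := cw)).
  - by move=> v w w1 _; exact: ltW.
have e8 : 0 < 8^-1 :> R by rewrite invr_gt0.
have [u [L [L0 uL uW]]] := lipschitz_approx cW e8.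
have [p p8 pu] := lipschitz_miss ne L0 uL e8.
have cu : continuous u by exact: continuous_lipschitz uL.
pose u' v := u (retr v).
have cu' : continuous u' by apply: (cont_comp cu); apply: cont_retr; exact: cont_id.
(* [h] is replaced by [u'] where its coordinates have norm at most [1/4], and kept
   where they have norm at least [1/2] *)
pose k (q : 'rV[R]_n * R) : M :=
  if coord_in e (h q.1) is Some w
  then chi e (w + (clamp q.2 * clamp (2 - 4 * `|w|)) *: (u' q.1 - w)) else h q.1.
have kin v t w : `|w| < 1 -> h v = chi e w ->
    k (v, t) = chi e (w + (clamp t * clamp (2 - 4 * `|w|)) *: (u' v - w)).
  by move=> w1 hw; rewrite /k /= hw (coord_inE cw).
have kout v t : cell_of (h v) <> e -> k (v, t) = h v.
  by move=> ve; rewrite /k (coord_inN (cw := cw)).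
have small v w : `|w| < 1 -> h v = chi e w -> `|w| < 2^-1 -> `|u' v - w| <= 8^-1.
  move=> w1 hw w2; have := uW (retr v) (norm_retr_le v).
  by rewrite /W hr hw (coord_inE cw) // clamp_ge1 ?scale1r //; lra.
have lam0 (w : 'rV[R]_(dim e)) : 2^-1 <= `|w| -> clamp (2 - 4 * `|w|) = 0 :> R.
  by move=> w2; rewrite clamp_le0 //; lra.
have c01 (r : R) := conj (clamp_ge0 r) (clamp_le1 r).
have dist v w (l : R) : `|w| < 1 -> h v = chi e w -> `|w| < 2^-1 -> 0 <= l -> l <= 1 ->
    `|l *: (u' v - w)| <= 8^-1.
  move=> w1 hw w2 l0 l1; rewrite normrZ ger0_norm //.
  by apply: le_trans (small v w w1 hw w2); rewrite ler_piMl.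
exists k; split.
- apply: (@continuous_top_cell _ _ (fun q : 'rV[R]_n * R => h q.1) k
    (fun q => h q.1) (ballc 1) (fun p => chi e (p.2 +
      (clamp p.1.2 * clamp (2 - 4 * `|p.2|)) *: (u' p.1.1 - p.2)))).
  + by cont.
  + by cont.
  + by have cc := continuous_chi cw (e := e); cont.
  + exact: compact_ballc.
  + by move=> q; exact: hes.
  + move=> [v t] w; rewrite /ballc /= le_eqVlt => /orP[/eqP w1 wh|w1 wh]; last exact: kin.
    rewrite kout; last by rewrite -wh; exact: boundary_not_top.
    by rewrite lam0 ?mulr0 ?scale0r ?addr0 // w1; lra.
  + by move=> [v t] ve; exact: kout.
  + by move=> q w w1 _; exact: ltW.
- by move=> v t; rewrite /k /= hr /u' retrK.
- move=> v; have [[w w1 hw]|ve] := cell_cases cw e (h v); last by rewrite kout.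
  by rewrite (kin v _ w) // clamp0 mul0r scale0r addr0.
- exact: kout.
split.
  move=> v; have [[w w1 hw]|ve] := cell_cases cw e (h v); last by rewrite kout.
  rewrite (kin v _ w) // clamp1 mul1r; have [w2|w2] := leP 2^-1 `|w|.
    by rewrite lam0 // scale0r addr0 cell_of_chi // inE eqxx.
  rewrite cell_of_chi ?inE ?eqxx //.
  have [l0 l1] := c01 (2 - 4 * `|w|).
  apply: le_lt_trans (ler_normD _ _) _.
  by have := dist v w _ w1 hw w2 l0 l1; lra.
exists p; first by lra.
move=> v kp; have p1 : `|p| < 1 by lra.
have [[w w1 hw]|ve] := cell_cases cw e (h v); last first.
  by case: (ve); rewrite -[h v](kout v 1 ve) kp cell_of_chi.
have [l0 l1] := c01 (2 - 4 * `|w|).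
move: kp; rewrite (kin v _ w) // clamp1 mul1r; have [w2|w2] := leP 2^-1 `|w|.
  rewrite lam0 // scale0r addr0 => /(congr1 (coord_in e)).
  by rewrite !(coord_inE cw) // => -[wp]; move: w2 p8; rewrite wp; lra.
have d := dist v w _ w1 hw w2 l0 l1.
move=> /(congr1 (coord_in e)); rewrite !(coord_inE cw) //; last first.
  by apply: le_lt_trans (ler_normD _ _) _; lra.
move=> [wp]; have w4 : `|w| <= 4^-1.
  rewrite (_ : w = p - clamp (2 - 4 * `|w|) *: (u' v - w)); last by rewrite -wp addrK.
  by apply: le_trans (ler_normB _ _) _; lra.
apply: (pu (retr v)); first exact: norm_retr_le.
by rewrite -wp clamp_ge1 ?scale1r 1?addrC ?subrK //; lra.
Qed.

(** A map missing the point [chi e p] is pushed away from it onto the boundary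
    of [e]: the map [psi] vanishes only at [p] and fixes the boundary of the cube,
    and [w] is joined by a segment to the radial projection of [psi w]. *)
Lemma push_off_point n (h : 'rV[R]_n -> M) p : continuous h ->
    (forall v, h (retr v) = h v) -> (forall v, cell_of (h v) \in e :: s) ->
    `|p| < 1 -> (forall v, h v <> chi e p) ->
  exists k : 'rV[R]_n * R -> M, [/\ continuous k,
    forall v t, k (retr v, t) = k (v, t), forall v, k (v, 0) = h v,
    forall v t, cell_of (h v) <> e -> k (v, t) = h v &
    forall v, cell_of (k (v, 1)) \in s ++ bnd cw e].
Proof.
move=> ch hr hes p1 hp.
have cc := continuous_chi cw (e := e).
pose D : set 'rV[R]_(dim e) :=
  ballc 1 `&` [set w | exists2 v, ballc 1 v & chi e w = h v].
have cD : compact D.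
  apply: compact_closedI; first exact: compact_ballc.
  apply: (@closed_projection _ _ _ [set q | chi e q.1 = h q.2]).
    exact: compact_ballc.
  by apply: closed_equalizer; [exact: cw_hausdorff cw|cont|cont].
pose psi (w : 'rV[R]_(dim e)) := w - ((1 - `|w|) / (1 - `|p|)) *: p.
have p0 : 0 < 1 - `|p| by lra.
have cpsi : continuous psi by rewrite /psi; cont.
have psi1 w : `|w| = 1 -> psi w = w.
  by move=> w1; rewrite /psi w1 subrr mul0r scale0r subr0.
have psi0 w : D w -> 0 < `|psi w|.
  move=> [w1 [v v1 wv]]; rewrite normr_gt0; apply/eqP => /eqP.
  rewrite subr_eq0 => /eqP; set c := (_ / _) => wcp.
  have c0 : 0 <= c by rewrite divr_ge0 ?(ltW p0) // subr_ge0.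
  have : `|w| = c * `|p| by rewrite [in LHS]wcp normrZ ger0_norm.
  have : c * (1 - `|p|) = 1 - `|w| by rewrite /c divfK // gt_eqF.
  move=> c1 c2; have cE : c = 1 by lra.
  by apply: (hp v); rewrite -wv wcp cE scale1r.
have [d' d'0 d'P] := compact_pos_lower cD (cont_normv cpsi) psi0.
pose d := Num.min d' 1.
have d0 : 0 < d by rewrite lt_min d'0 ltr01.
(* equal to [psi w / |psi w|] on [D], but continuous everywhere *)
pose N w := (Num.max d `|psi w|)^-1 *: psi w.
have cN : continuous N.
  rewrite /N; apply: cont_scale => //; apply: cont_inv; last by cont.
  by move=> w; rewrite gt_eqF // lt_max d0.
have N1 w : `|w| = 1 -> N w = w.
  move=> w1; rewrite /N psi1 // w1 max_r ?invr1 ?scale1r //.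
  by rewrite ge_min lexx orbT.
have ND w : D w -> `|N w| = 1.
  move=> Dw; have dw : d <= `|psi w| by rewrite ge_min d'P.
  rewrite /N max_r // normrZ ger0_norm ?invr_ge0 // mulVf //.
  by rewrite gt_eqF // psi0.
have inD v w : `|w| < 1 -> h v = chi e w -> D w.
  move=> w1 hv; split; first exact: ltW.
  by exists (retr v); [exact: norm_retr_le|rewrite hr].
pose k (q : 'rV[R]_n * R) : M :=
  if coord_in e (h q.1) is Some w
  then chi e ((1 - clamp q.2) *: w + clamp q.2 *: N w) else h q.1.
have kin v t w : `|w| < 1 -> h v = chi e w ->
    k (v, t) = chi e ((1 - clamp t) *: w + clamp t *: N w).
  by move=> w1 hw; rewrite /k /= hw (coord_inE cw).
have kout v t : cell_of (h v) <> e -> k (v, t) = h v.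
  by move=> ve; rewrite /k (coord_inN (cw := cw)).
exists k; split.
- apply: (@continuous_top_cell _ _ (fun q : 'rV[R]_n * R => h q.1) k
    (fun q => h q.1) D (fun q => chi e ((1 - clamp q.1.2) *: q.2 +
      clamp q.1.2 *: N q.2))) => //; try by cont.
  + move=> [v t] w [+ _]; rewrite /ballc /= le_eqVlt => /orP[/eqP w1 wh|w1 wh]; last exact: kin.
    rewrite kout; last by rewrite -wh; exact: boundary_not_top.
    by rewrite N1 // -scalerDl subrK scale1r.
  + by move=> [v t] ve; exact: kout.
  + by move=> [v t] w w1; exact: inD.
- by move=> v t; rewrite /k /= hr.
- move=> v; have [[w w1 hw]|ve] := cell_cases cw e (h v); last by rewrite kout.
  by rewrite (kin v _ w) // clamp0 subr0 scale1r scale0r addr0.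
- exact: kout.
move=> v; have [[w w1 hw]|ve] := cell_cases cw e (h v); rewrite mem_cat.
  rewrite (kin v _ w) // clamp1 subrr scale0r add0r scale1r mem_bnd ?orbT //.
  by apply: ND; exact: inD hw.
by rewrite kout //; have := hes v; rewrite inE => /predU1P[//|->].
Qed.

End top_cell.

(** Rest on the points of the [n]-skeleton, unlike rest on the boundary of the cube,
    is a condition on the values of [h]; it makes deformations composable and
    implies the other one when the boundary is mapped to the [n]-skeleton. *)
Definition deforms n (h h' : 'rV[R]_n -> M) : Prop :=
  exists k : 'rV[R]_n * R -> M, [/\ continuous k,
    forall v t, k (retr v, t) = k (v, t), forall v, k (v, 0) = h v,
    forall v, k (v, 1) = h' v &
    forall v t, (dim (cell_of (h v)) <= n)%N -> k (v, t) = h v].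

Lemma deforms_refl n (h : 'rV[R]_n -> M) : continuous h ->
  (forall v, h (retr v) = h v) -> deforms h h.
Proof.
by move=> ch hr; exists (fun q => h q.1); split => [|v t|||] //=; cont.
Qed.

Lemma deforms_end n (h h' : 'rV[R]_n -> M) : deforms h h' ->
  continuous h' /\ forall v, h' (retr v) = h' v.
Proof.
move=> [k [ck kr _ k1 _]]; split => [|v]; last by rewrite -!k1 kr.
by rewrite (_ : h' = fun v => k (v, 1)); [cont|apply/funext => v; rewrite k1].
Qed.

Lemma deforms_trans n (h h' h'' : 'rV[R]_n -> M) :
  deforms h h' -> deforms h' h'' -> deforms h h''.
Proof.
move=> [k [ck kr k0 k1 ks]] [l [cl lr l0 l1 ls]].
exists (fun q => if q.2 * 2 <= 1 then k (q.1, q.2 * 2) else l (q.1, q.2 * 2 - 1)).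
split => [|v t|v|v|v t vn] /=.
- apply: cont_if; try by cont.
  by move=> [v t] /= ->; rewrite subrr k1 l0.
- by rewrite kr lr.
- by rewrite mul0r ler01.
- rewrite ifF; last by apply/negbTE; rewrite -ltNge; lra.
  by rewrite (_ : 1 * 2 - 1 = 1) //; ring.
- have hh' : h' v = h v by rewrite -k1 ks.
  by rewrite ks // ls ?hh' // if_same.
Qed.

(** The cells of largest dimension [n + m.+1] met by the map are removed one by one;
    each of them is traded for cells of smaller dimension. *)
Lemma compress n (h : 'rV[R]_n -> M) (s : seq cell) : continuous h ->
    (forall v, h (retr v) = h v) -> (forall v, cell_of (h v) \in s) ->
  exists (h' : 'rV[R]_n -> M) (s' : seq cell), [/\ deforms h h',
    forall v, cell_of (h' v) \in s' & forall e, e \in s' -> (dim e <= n)%N].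
Proof.
have [m] : exists m, forall e, e \in s -> (dim e <= n + m)%N.
  exists (\max_(e <- s) dim e) => e es.
  by apply: leq_trans (leq_addl _ _); exact: leq_bigmax_seq.
elim: m h s => [|m IHm] h s sn.
  by move=> ch hr hs; exists h, s; split => //; [exact: deforms_refl|move=> e /sn; rewrite addn0].
pose P := [pred e : cell | dim e == (n + m.+1)%N].
have [N] := ubnP (count P s); elim: N h s sn => // N IHN h s sn sN ch hr hs.
have [/hasP [e es /eqP de]|/hasPn nP] := boolP (has P s); last first.
  apply: (IHm h s) => // e es; have := nP e es; have := sn e es.
  by rewrite /= leq_eqVlt addnS ltnS => /predU1P[->|//]; rewrite eqxx.
pose s0 := [seq x <- s | x != e].
have es0 : e \notin s0 by rewrite mem_filter eqxx.
have se0 e' : e' \in s0 -> (dim e' <= dim e)%N.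
  by rewrite mem_filter de => /andP[_ /sn].
have hes v : cell_of (h v) \in e :: s0.
  by rewrite inE mem_filter hs andbT; case: eqP.
have ne : (n < dim e)%N by rewrite de addnS ltnS leq_addr.
have ne' v : (dim (cell_of (h v)) <= n)%N -> cell_of (h v) <> e.
  by move=> + E; rewrite E leqNgt ne.
have [k [ck kr k0 ks [kes [p p1 kp]]]] := avoid_point es0 se0 ne ch hr hes.
have ck1 : continuous (fun v => k (v, 1)) by cont.
have [l [cl lr l0 ls les]] :=
  push_off_point es0 se0 ck1 (fun v => kr v 1) kes p1 kp.
have hk : deforms h (fun v => k (v, 1)).
  by exists k; split => // v t /ne'; exact: ks.
have kl : deforms (fun v => k (v, 1)) (fun v => l (v, 1)).
  exists l; split => // v t vn; apply: ls => ve.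
  by move: vn; rewrite ve leqNgt ne.
have hl := deforms_trans hk kl; have [cl1 lr1] := deforms_end hl.
have [||h' [s' [lh' hs' s'n]]] := IHN (fun v => l (v, 1)) (s0 ++ bnd cw e) _ _ cl1 lr1 les.
- move=> e'; rewrite mem_cat => /orP[/se0|/dim_bnd /ltnW]; by rewrite de.
- rewrite count_cat [X in (_ + X)%N](_ : _ = 0%N) ?addn0.
    apply: leq_trans _ (_ : count P s <= N)%N; last by rewrite -ltnS.
    have /permP/(_ P) := permEl (perm_filterC (pred1 e) s).
    rewrite count_cat => <-; rewrite -[X in (X < _)%N]add0n ltn_add2r.
    by rewrite -has_count; apply/hasP; exists e => //=; rewrite ?mem_filter /= ?eqxx ?de.
  apply/eqP; rewrite -leqn0 leqNgt -has_count; apply/hasPn => e' /dim_bnd.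
  by rewrite de /= => /ltn_eqF ->.
by exists h', s'; split => //; exact: deforms_trans lh'.
Qed.

End compression.

(** * Cellular approximation *)

Section cellular_approximation.
Context {R : realType} {K M : ptopologicalType} {CK CM : nat -> Type}.
Context {phiK : forall n, CK n -> 'rV[R]_n -> K} (cwK : cw_structure phiK).
Context {phiM : forall n, CM n -> 'rV[R]_n -> M} (cwM : cw_structure phiM).
Variable f : K -> M.
Hypothesis cf : continuous f.
Local Notation chi := (chi phiK).
Local Notation dimK y := (dim (cell_of cwK y)).
Local Notation dimM y := (dim (cell_of cwM y)).

(** [F] is a deformation of [f], on the closed cell [e], that stops at time
    [dim e + 1] in a finite union of cells of dimension at most [dim e]; the time
    is unbounded so that the deformation of [e] can extend those of the cells of
    its boundary, which have already stopped, without reparametrization. *)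
Definition deforms_cell (e : @cell CK) (F : 'rV[R]_(dim e) * R -> M) : Prop :=
  [/\ continuous F, forall v t, `|v| <= 1 -> t <= 0 -> F (v, t) = f (chi e v),
    forall v t, (dim e).+1%:R <= t -> F (v, t) = F (v, (dim e).+1%:R),
    exists s : seq (@cell CM), (forall e', e' \in s -> (dim e' <= dim e)%N) /\
      forall v, cell_of cwM (F (v, (dim e).+1%:R)) \in s &
    dim e = 0%N -> forall v t, dimM (f (chi e v)) = 0%N -> F (v, t) = f (chi e v)].

Definition extends (H : K -> R -> M) (e : @cell CK) (F : 'rV[R]_(dim e) * R -> M) :=
  forall v t, `|v| <= 1 -> H (chi e v) t = F (v, t).

Section extend.
Variables (e : @cell CK) (H : K -> R -> M).
Hypothesis Hgood : forall e' : @cell CK, (dim e' < dim e)%N ->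
  exists F, deforms_cell F /\ extends H F (e := e').

Let n := dim e.
Let tp (t : R) := Num.max 0 t.
Let mu (q : 'rV[R]_n * R) := Num.max `|q.1| (1 + tp q.2)^-1.
Let nu (q : 'rV[R]_n * R) := (mu q)^-1 *: q.1.
Let ht (q : 'rV[R]_n * R) := 1 + tp q.2 - (mu q)^-1.

Let tp_ge0 t : 0 <= tp t. Proof. by rewrite /tp le_max lexx. Qed.
Let tp_gt0 t : 0 < 1 + tp t. Proof. by have := tp_ge0 t; lra. Qed.
Let mu_gt0 q : 0 < mu q. Proof. by rewrite /mu lt_max invr_gt0 tp_gt0 orbT. Qed.

Let continuous_tp : continuous tp. Proof. by rewrite /tp; cont. Qed.
Let continuous_mu : continuous mu.
Proof.
rewrite /mu; apply: cont_max; first by cont.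
by apply: cont_inv; [move=> x; rewrite gt_eqF|have ct := continuous_tp; cont].
Qed.
Let continuous_muV : continuous (fun q => (mu q)^-1).
Proof. by apply: cont_inv; [move=> x; rewrite gt_eqF|exact: continuous_mu]. Qed.
Let continuous_nu : continuous nu.
Proof. by apply: cont_scale; [exact: continuous_muV|cont]. Qed.
Let continuous_ht : continuous ht.
Proof.
apply: cont_add; first by have ct := continuous_tp; cont.
exact/cont_opp/continuous_muV.
Qed.

(* The cylinder over the cube is projected from above onto its bottom (where
   [(1 + t) * |v| <= 1]) and its side. *)
Let h0 (q : 'rV[R]_n * R) : M :=
  if (1 + tp q.2) * `|q.1| <= 1 then f (chi e ((1 + tp q.2) *: q.1))
  else H (chi e (nu q)) (ht q).

Let outer_mu q : 1 <= (1 + tp q.2) * `|q.1| -> mu q = `|q.1|.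
Proof. by move=> h; rewrite /mu max_l // -[X in X <= _]mulr1 ler_pdivrMl. Qed.

Let norm_nu q : 1 <= (1 + tp q.2) * `|q.1| -> `|nu q| = 1.
Proof.
move=> h; have := mu_gt0 q; rewrite /nu normrZ outer_mu // => m0.
by rewrite ger0_norm ?invr_ge0 // mulVf // gt_eqF.
Qed.

Let continuous_h0 : continuous h0.
Proof.
have cc := continuous_chi cwK (e := e); have ct := continuous_tp.
have cH := continuous_ht; have cnu := continuous_nu.
pose r (q : 'rV[R]_n * R) := (1 + tp q.2) * `|q.1|.
have cr : continuous r by rewrite /r; cont.
apply: (@cont_on_glue _ _ [set q | r q <= 1] [set q | 1 <= r q]).
- by move=> q; case: (leP (r q) 1) => h; [left|right; exact: ltW].
- apply: (cont_on_eq (l := fun q : 'rV[R]_n * R => f (chi e ((1 + tp q.2) *: q.1)))).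
  + by apply: (@preimage_closed _ _ r [set x | x <= 1]); [move=> q _; exact: cr|exact: closed_le].
  + by cont.
  + by move=> q /= h; rewrite /h0 -/(r q) h.
pose F e' := match pselect (dim e' < n)%N with
  | left h => projT1 (cid (Hgood h)) | right _ => fun=> point end.
have FP e' : (dim e' < n)%N -> deforms_cell (F e') /\ extends H (F e').
  by rewrite /F; case: pselect => // h _; exact: (projT2 (cid (Hgood h))).
apply: (@cont_on_cells _ _ _ _ cwK _ _ (fun q : 'rV[R]_n * R => chi e (nu q)) _ _ _ _ (bnd cwK e)
    (fun e' => ballc 1) (fun e' q => F e' (q.2, ht q.1))) => //.
- by cont.
- by apply: (@preimage_closed _ _ r [set x | 1 <= x]); [move=> q _; exact: cr|exact: closed_ge].
- by move=> e' _; exact: compact_ballc.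
- by move=> e' /dim_bnd /FP [[cF _ _ _ _] _]; cont.
- move=> e' q w /dim_bnd /FP [[_ F0 _ _ _] HF] q1 w1 wq.
  rewrite /h0; case: ifP => q2; last by rewrite -wq HF.
  have qE : r q = 1 by apply/eqP; rewrite eq_le q1 q2.
  have n0 : `|q.1| != 0 by apply/eqP => n0; move: qE; rewrite /r n0 mulr0; lra.
  have muE : (mu q)^-1 = 1 + tp q.2.
    by rewrite outer_mu //; apply: (mulIf n0); rewrite mulVf //; exact/esym.
  by rewrite /ht muE subrr F0 // wq /nu muE.
- by move=> q q1; apply: (cover_cells (cw := cwK)); apply: mem_bnd; exact: norm_nu.
Qed.

(** On the boundary of [e] the deformation is given, and it has stopped. *)
Let on_boundary v : `|v| = 1 -> exists e' F w, [/\ (dim e' < n)%N, @deforms_cell e' F,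
  `|w| <= 1, chi e v = chi e' w & forall t, H (chi e v) t = F (w, t)].
Proof.
move=> /(mem_bnd cwK) ve; have [e' e's [w w1 wv]] := cover_cells ve.
have [F [dF HF]] := Hgood (dim_bnd e's).
exists e', F, w; split => //; [exact: dim_bnd e's|by move=> t; rewrite -HF // wv].
Qed.

Let boundary0 v t : `|v| = 1 -> t <= 0 -> H (chi e v) t = f (chi e v).
Proof.
by move=> /on_boundary [e' [F [w [_ [_ F0 _ _ _] w1 -> ->]]]] t0; rewrite F0.
Qed.

Let boundary_stop v t : `|v| = 1 -> n%:R <= t -> H (chi e v) t = H (chi e v) n%:R.
Proof.
move=> /on_boundary [e' [F [w [e'n [_ _ Fs _ _] w1 _ HF]]]] nt; rewrite !HF.
have e'nR : (dim e').+1%:R <= n%:R :> R by rewrite ler_nat.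
by rewrite (Fs w n%:R) // (Fs w t) //; exact: le_trans nt.
Qed.

Let boundary_dim v : `|v| = 1 -> (dimM (H (chi e v) n%:R) <= n)%N.
Proof.
move=> /on_boundary [e' [F [w [e'n [_ _ Fs [s [ss sF]] _] w1 _ ->]]]].
rewrite Fs ?ler_nat //; apply: leq_trans (ltnW e'n); apply: ss; exact: sF.
Qed.

Let h0_boundary v t : `|v| = 1 -> h0 (v, t) = H (chi e v) t.
Proof.
move=> v1; rewrite /h0 /= v1 mulr1; have [t0|t0] := leP t 0.
  by rewrite /tp max_l // addr0 lexx scale1r boundary0.
have tpE : tp t = t by rewrite /tp max_r // ltW.
rewrite ifF; last by apply/negbTE; rewrite -ltNge tpE; lra.
have muE : mu (v, t) = 1.
  by rewrite outer_mu //= v1 mulr1 tpE; lra.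
by rewrite /nu /ht muE invr1 scale1r /= tpE addrAC subrr add0r.
Qed.

(** The deformation given on the boundary is extended to the cell by [h0] until time
    [dim e], when the boundary has stopped; the last unit of time is used to push the
    resulting map of the cube into the cells of its dimension. *)
Lemma extend_cell : exists F : 'rV[R]_(dim e) * R -> M, deforms_cell F /\
  forall v t, `|v| = 1 -> F (v, t) = H (chi e v) t.
Proof.
pose h v := h0 (retr v, n%:R).
have ch : continuous h.
  have c0 := continuous_h0; rewrite /h; apply: (cont_comp c0); apply: cont_pair.
    by apply: cont_retr; cont.
  by cont.
have hr v : h (retr v) = h v by rewrite /h retrK.
have [s hs] : exists s : seq (@cell CM), forall v, cell_of cwM (h v) \in s.
  have [|s sP] := compact_cells cwM (A := h @` ballc 1).
    by apply: continuous_compact; [exact: continuous_subspaceT|exact: compact_ballc].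
  exists s => v; apply: sP; exists (retr v) => //; exact: norm_retr_le.
have [h' [s' [[k [ck kr k0 k1 ks]] hs' sn']]] := compress ch hr hs.
pose F (q : 'rV[R]_n * R) :=
  if q.2 <= n%:R then h0 (retr q.1, q.2) else k (q.1, clamp (q.2 - n%:R)).
have retr1 v : `|v| = 1 -> retr v = v by move=> v1; rewrite retr_id // v1.
have Fend v t : n.+1%:R <= t -> F (v, t) = k (v, 1).
  rewrite -natr1 => nt; rewrite /F /= ifF; last by apply/negbTE; rewrite -ltNge; lra.
  by rewrite clamp_ge1 //; lra.
have n0 : 0 <= n%:R :> R by rewrite ler0n.
exists F; split; first split.
- have c0 := continuous_h0; apply: cont_if; try by cont.
    by apply: (cont_comp c0); apply: cont_pair; [apply: cont_retr; cont|cont].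
  by move=> [v t] /= ->; rewrite subrr clamp0 k0.
- move=> v t v1 t0; rewrite /F /= (le_trans t0 n0) retr_id // /h0 /=.
  by rewrite /tp max_l // addr0 mul1r v1 scale1r.
- by move=> v t nt; rewrite !Fend.
- by exists s'; split => // v; rewrite Fend // k1.
- move=> d0 v t fv.
  have thin (w : 'rV[R]_(dim e)) : w = v.
    by apply/rowP => -[i li]; exfalso; rewrite d0 in li.
  have vn : `|v| = 0 by rewrite -(thin 0) normr0.
  have h0E x : h0 (v, x) = f (chi e v) by rewrite /h0 /= vn mulr0 ler01 (thin (_ *: v)).
  rewrite /F /= (thin (retr v)); case: ifP => _; first exact: h0E.
  by rewrite ks /h (thin (retr v)) h0E // fv.
move=> v t v1; rewrite /F /= retr1 //; case: ifP => nt; first exact: h0_boundary.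
have hE : h v = H (chi e v) n%:R by rewrite /h retr1 // h0_boundary.
have tn : n%:R <= t by rewrite leNgt; apply/negP => /ltW; rewrite nt.
by rewrite ks hE ?boundary_dim // (boundary_stop (t := t)).
Qed.

End extend.

(** The deformation is built by recursion on skeleta: [stage n] is meaningful on the
    cells of dimension less than [n]. *)
Definition extension (H : K -> R -> M) (e : @cell CK) : 'rV[R]_(dim e) * R -> M :=
  if pselect (exists F, deforms_cell F /\ forall v t, `|v| = 1 -> F (v, t) = H (chi e v) t)
    is left ex then projT1 (cid ex) else fun=> point.

Fixpoint stage (n : nat) : K -> R -> M :=
  if n is n'.+1 then fun y =>
    if dimK y == n' then cellwise cwK (fun e v t => @extension (stage n') e (v, t)) y
    else stage n' y
  else fun y _ => f y.

Lemma stage_good n (e : @cell CK) : (dim e < n)%N ->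
  exists F, deforms_cell F /\ extends (stage n) F (e := e).
Proof.
elim: n e => // n IHn e; rewrite ltnS leq_eqVlt => /predU1P[en|en]; last first.
  have [F [dF HF]] := IHn e en; exists F; split => // v t v1.
  rewrite /= ifF ?HF //; apply/negbTE; rewrite neq_ltn.
  by rewrite (leq_ltn_trans (dim_closed_cell cwK v) en).
have exF : exists F, deforms_cell F /\ forall v t, `|v| = 1 -> F (v, t) = stage n (chi e v) t.
  by apply: extend_cell => e'; rewrite en; exact: IHn.
exists (@extension (stage n) e).
have [dF bF] : deforms_cell (@extension (stage n) e) /\
    forall v t, `|v| = 1 -> @extension (stage n) e (v, t) = stage n (chi e v) t.
  by rewrite /extension; case: pselect => // ex; exact: (projT2 (cid ex)).
split => // v t; rewrite le_eqVlt => /predU1P[v1|v1] /=.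
  rewrite bF // ifF //; apply/negbTE; rewrite neq_ltn -en.
  by rewrite (dim_bnd (mem_bnd cwK v1)).
by rewrite ifT ?cellwiseE // cell_of_chi //; exact/eqP.
Qed.

Definition stages (y : K) : R -> M := stage (dimK y).+1 y.

Lemma stage_stable y m : (dimK y <= m)%N -> stage m.+1 y = stages y.
Proof.
elim: m => [|m IHm]; first by rewrite leqn0 /stages => /eqP ->.
rewrite leq_eqVlt => /predU1P[<-//|]; rewrite ltnS => dm.
by rewrite -IHm // [in LHS]/= ifF // ltn_eqF // ltnS.
Qed.

Lemma stages_good (e : @cell CK) : exists F, deforms_cell F /\ extends stages F (e := e).
Proof.
have [F [dF HF]] := @stage_good (dim e).+1 e (leqnn _).
exists F; split => // v t v1.
by rewrite -HF // (stage_stable (dim_closed_cell cwK v)).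
Qed.

(* The unbounded time is squeezed into the unit interval; only the time before
   [N] matters on cells of dimension less than [N]. *)
Let squeeze (N : nat) (t : R) : R := clamp t / Num.max (1 - clamp t) N.+1%:R^-1.

Let max_squeeze_gt0 (N : nat) (t : R) : 0 < Num.max (1 - clamp t) N.+1%:R^-1.
Proof. by rewrite lt_max invr_gt0 ltr0n orbT. Qed.

Let continuous_squeeze N : continuous (squeeze N).
Proof.
have cc : continuous (@clamp R) by apply: cont_clamp; exact: cont_id.
apply: cont_mul; first by cont.
by apply: cont_inv; [move=> t; rewrite gt_eqF|cont].
Qed.

Let squeeze0 N : squeeze N 0 = 0. Proof. by rewrite /squeeze clamp0 mul0r. Qed.
Let squeeze1 N : squeeze N 1 = N.+1%:R.
Proof. by rewrite /squeeze clamp1 subrr max_r ?invr_ge0 // mul1r invrK. Qed.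

Let squeeze_stable (a : R -> M) N N' t : (N <= N')%N ->
  (forall t, N%:R <= t -> a t = a N%:R) -> a (squeeze N t) = a (squeeze N' t).
Proof.
move=> NN' aN; rewrite /squeeze; set c := clamp t.
have c0 : 0 <= c by exact: clamp_ge0.
have NN'V : N'.+1%:R^-1 <= N.+1%:R^-1 :> R by rewrite lef_pV2 ?posrE ?ltr0n // ler_nat.
have [h|h] := leP (N.+1%:R^-1) (1 - c).
  by rewrite !max_l // (le_trans NN'V).
have big m : 0 < m -> m <= N.+1%:R^-1 -> N%:R <= c / m.
  move=> m0 mN; apply: (@le_trans _ _ (c * N.+1%:R)); last first.
    by rewrite ler_wpM2l // -[X in X <= _]invrK lef_pV2 ?posrE // invr_gt0 ltr0n.
  have N1 : 0 < N.+1%:R :> R by rewrite ltr0n.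
  have : (1 - N.+1%:R^-1) * N.+1%:R <= c * N.+1%:R by rewrite ler_wpM2r ?(ltW N1) // lerBlDl -lerBlDr ltW.
  by rewrite mulrBl mul1r mulVf ?gt_eqF // -natr1 addrK.
have m0 := max_squeeze_gt0 N t; have m0' := max_squeeze_gt0 N' t.
rewrite aN ?[RHS]aN //; apply: big => //; rewrite ge_max ltW ?NN'V //=.
Qed.

(** The homotopy rests on the vertices already mapped to vertices, in particular on
    the base point. *)
Theorem cellular_approximation : exists H : K * R -> M, [/\ continuous H,
  forall y, H (y, 0) = f y,
  forall e : @cell CK, exists s : seq (@cell CM), (forall e', e' \in s -> (dim e' <= dim e)%N) /\
    forall v, cell_of cwM (H (chi e v, 1)) \in s &
  forall y t, dimK y = 0%N -> dimM (f y) = 0%N -> H (y, t) = f y].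
Proof.
pose H (q : K * R) := stages q.1 (squeeze (dimK q.1).+1 q.2).
have HF e : exists F, deforms_cell F /\
    forall v t, H (chi e v, t) = F (retr v, squeeze (dim e).+1 t).
  have [F [dF sF]] := stages_good e; exists F; split => // v t.
  rewrite -sF ?norm_retr_le // chi_retr /H /=.
  apply: squeeze_stable; first by rewrite ltnS dim_closed_cell.
  move=> r; set y := chi e v.
  have [F' [[_ _ F's _ _] sF']] := stages_good (cell_of cwK y).
  have w1 := ltW (norm_coord cwK y).
  have E x : stages y x = F' (coord cwK y, x) by rewrite -sF' // coordK.
  by move=> yr; rewrite !E F's.
have cF e F : @deforms_cell e F -> continuous (fun q : 'rV[R]_(dim e) * R =>
    F (retr q.1, squeeze (dim e).+1 q.2)).
  move=> [cF _ _ _ _]; have cs := continuous_squeeze (N := (dim e).+1).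
  by apply: (cont_comp cF); apply: cont_pair; [apply: cont_retr; cont|cont].
exists H; split.
- have cH : continuous (curry H : K -> {compact-open, R -> M}).
    apply: (cw_continuousP cwK) => e; have [F [dF EF]] := HF e.
    rewrite (_ : (fun v => _) = curry (fun q : 'rV[R]_(dim e) * R =>
      F (retr q.1, squeeze (dim e).+1 q.2))); last first.
      by apply/funext => v; apply/funext => t; rewrite /curry EF.
    exact: (continuous_curry (cF e F dF)).1.
  rewrite (_ : H = uncurry (curry H)); last by apply/funext => -[].
  apply: continuous_uncurry => //; first exact: locally_compactR.
  move=> y; have [F [dF EF]] := HF (cell_of cwK y).
  rewrite (_ : curry H y = curry (fun q => F (retr q.1, squeeze (dimK y).+1 q.2)) (coord cwK y)).
    exact: (continuous_curry (cF _ F dF)).2.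
  by apply/funext => t; rewrite /curry -EF coordK.
- move=> y; have [F [[_ F0 _ _ _] EF]] := HF (cell_of cwK y).
  have w1 := ltW (norm_coord cwK y).
  by rewrite -(coordK cwK y) EF squeeze0 F0 ?norm_retr_le // chi_retr.
- move=> e; have [F [[_ _ Fs [s [ss sF]] _] EF]] := HF e.
  exists s; split => // v; rewrite EF squeeze1 Fs //.
  by rewrite ler_nat.
move=> y t y0; have [F [[_ _ _ _ Fb] EF]] := HF (cell_of cwK y).
rewrite -(coordK cwK y) EF => fy; rewrite Fb ?chi_retr //.
Qed.

End cellular_approximation.

(** * The mapping cone of a cellular map *)

Section cone_topology.
Context {R : realType} {A B : ptopologicalType} (f : A -> B).
Hypothesis bf : based_map f.
Local Notation C := (mapping_cone R f).
Local Notation cin := (cone_in R f).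
Local Notation cpt := (cone_pt (R := R) f).

Lemma cone_in_inj : injective cin.
Proof. by move=> y y' /cone_piP /= h; exact: (existT_inj2 h). Qed.

Lemma cone_glue_pt x (r : R) : x <> point -> 0 < r -> r < 1 ->
  cone_glue f (existT (cone_part R A B) false (x, to_itv r)) =
  existT (cone_part R A B) false (x, to_itv r).
Proof.
move=> /eqP/negbTE xp r0 r1 /=; rewrite xp orbF.
have rE : of_itv (to_itv r) = r by rewrite to_itvK clamp_id // ltW.
have -> : (to_itv r == itv1 R) = false.
  by apply/eqP => /(congr1 of_itv); rewrite rE of_itv1 => h; move: r1; rewrite h ltxx.
have -> // : (to_itv r == itv0 R) = false.
by apply/eqP => /(congr1 of_itv); rewrite rE of_itv0 => h; move: r0; rewrite h ltxx.
Qed.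

Lemma cone_pt_inj x x' (r r' : R) : x <> point -> x' <> point ->
    0 < r -> r < 1 -> 0 < r' -> r' < 1 -> cpt (x, r) = cpt (x', r') ->
  x = x' /\ r = r'.
Proof.
move=> xp xp' r0 r1 r0' r1' /cone_piP; rewrite !cone_glue_pt // => h.
have h2 := existT_inj2 h; split; first exact: (congr1 fst h2).
have := congr1 (fun p : A * unit_interval R => of_itv p.2) h2.
by rewrite /= !to_itvK !clamp_id ?(ltW r0) ?(ltW r1) ?(ltW r0') ?(ltW r1').
Qed.

Lemma cone_pt_neq_in x (r : R) y : x <> point -> 0 < r -> r < 1 -> cpt (x, r) <> cin y.
Proof. by move=> xp r0 r1 /cone_piP; rewrite cone_glue_pt. Qed.

Lemma cone_openP (U : set C) :
  open (cin @^-1` U) -> open (cpt @^-1` U) -> open U.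
Proof.
move=> oin opt; rewrite /open /= /quotient_open; apply/sigT_openP => -[]; first exact: oin.
have ci := @continuous_of_itv R.
have cq : continuous (fun p : A * unit_interval R => (p.1, of_itv p.2)) by cont.
have := (iffLR (continuousP _) cq) _ opt; congr open.
by apply/seteqP; split => -[x t] /=; rewrite /cone_pt /= of_itvK.
Qed.

Lemma cone_closedP (U : set C) :
  closed (cin @^-1` U) -> closed (cpt @^-1` U) -> closed U.
Proof.
move=> /closed_openC oin /closed_openC opt; rewrite -openC.
by apply: cone_openP.
Qed.

Lemma cone_open_set (u : set B) (H : set (A * R)) : open u -> open H ->
    (forall x, H (x, 1) <-> u (f x)) -> (forall x, H (x, 0) <-> u point) ->
    (forall r, 0 <= r -> r <= 1 -> H (point, r) <-> u point) ->
  exists S : set C, [/\ open S, forall y, S (cin y) <-> u y &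
    forall x r, 0 <= r -> r <= 1 -> S (cpt (x, r)) <-> H (x, r)].
Proof.
move=> ou oH /(_ _)/propext H1 /(_ _)/propext H0 Hb.
have Hb' r : 0 <= r -> r <= 1 -> H (point, r) = u point.
  by move=> r0 r1; apply/propext; exact: Hb.
pose S : set C := cone_lift u H.
have Sin y : S (cin y) = u y by rewrite /S cone_lift_in.
have Spt x r : S (cpt (x, r)) = H (x, clamp r) by rewrite /S cone_lift_pt.
exists S; split => [|y|x r r0 r1]; last 2 first.
- by rewrite Sin.
- by rewrite Spt clamp_id.
apply: cone_openP.
  by rewrite (_ : _ @^-1` _ = u) //; apply/seteqP; split => y /=; rewrite Sin.
have cc : continuous (fun p : A * R => (p.1, clamp p.2)) by cont.
have := (iffLR (continuousP _) cc) _ oH; congr open.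
by apply/seteqP; split => -[x r] /=; rewrite Spt.
Qed.

Lemma hausdorff_sep (T : topologicalType) (x y : T) : hausdorff_space T -> x <> y ->
  exists U V : set T, [/\ open U, open V, U x, V y & forall z, U z -> V z -> False].
Proof.
rewrite open_hausdorff => hT /eqP /hT [[U V] /= [/set_mem Ux /set_mem Vy] [oU oV /eqP UV]].
by exists U, V; split => // z Uz Vz; have : (U `&` V) z by []; rewrite UV.
Qed.

Lemma sep_hausdorff (T : topologicalType) : (forall x y : T, x <> y ->
    exists U V : set T, [/\ open U, open V, U x, V y & forall z, U z -> V z -> False]) ->
  hausdorff_space T.
Proof.
move=> sep; rewrite open_hausdorff => x y /eqP /sep [U [V [oU oV Ux Vy UV]]].
exists (U, V); first by split; apply: mem_set.
by split => //; apply/eqP/seteqP; split => // z [Uz Vz]; exact: UV Vz.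
Qed.

Let openX (U : set A) (V : set R) : open U -> open V -> open (U `*` V).
Proof. by move=> oU oV; apply: openI; apply: open_comp => // x _; [exact: cvg_fst|exact: cvg_snd]. Qed.

Lemma open_between (a b : R) : open [set r : R | a < r /\ r < b].
Proof. by apply: openI; [exact: open_gt|exact: open_lt]. Qed.

(** Points of the open cylinder are separated in the cylinder; two points of the base
    by open sets of the base, continued over the outer half of the cylinder, except
    that a neighbourhood of the base point has to contain the inner half and the
    generator of the base point. *)
Lemma cone_hausdorff : hausdorff_space A -> hausdorff_space B -> hausdorff_space C.
Proof.
move=> hA hB; have [cf fp] := bf; apply: sep_hausdorff.
have oNp : open (~` [set point : A]).
  by apply/closed_openC/accessible_closed_set1/hausdorff_accessible.
have oT (V : set R) : open V -> open [set p : A * R | V p.2].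
  by move=> oV; apply: (@open_comp _ _ snd) => // x _; exact: cvg_snd.
have oF (U : set A) : open U -> open [set p : A * R | U p.1].
  by move=> oU; apply: (@open_comp _ _ fst) => // x _; exact: cvg_fst.
have sym (P : C -> C -> Prop) : (forall p q, P p q -> P q p) -> True by [].
have inpt x r y : x <> point -> 0 < r -> r < 1 ->
    exists U V : set C, [/\ open U, open V, U (cpt (x, r)), V (cin y)
      & forall z, U z -> V z -> False].
  move=> xp r0 r1; pose d := Num.min r (1 - r) / 2.
  have [d0 dr dr1] : [/\ 0 < d, d < r & r < 1 - d].
    by split; rewrite /d; case: (leP r (1 - r)) => h; lra.
  have [N [N' [oN oN' Nx N'p NN']]] := hausdorff_sep hA xp.
  have [||||U [oU Uin Upt]] := @cone_open_set set0 (N `*` [set s | d < s /\ s < 1 - d]) open0.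
  - by apply: openX => //; exact: open_between.
  - by move=> z; split => // -[_ /= []]; lra.
  - by move=> z; split => // -[_ /= []]; lra.
  - by move=> s _ _; split => // -[Np _]; exact: NN' Np N'p.
  have [||||V [oV Vin Vpt]] := @cone_open_set setT
      ([set p | N' p.1] `|` [set p | p.2 < d] `|` [set p | 1 - d < p.2]) openT.
  - apply: openU; first apply: openU; first exact: oF.
      by apply: (oT [set s | s < d]); exact: open_lt.
    by apply: (oT [set s | 1 - d < s]); exact: open_gt.
  - by move=> z; split => // _; right => /=; lra.
  - by move=> z; split => // _; left; right => /=; lra.
  - by move=> s _ _; split => // _; left; left.
  exists U, V; split => //; first by apply/Upt; rewrite ?ltW.
    by apply/Vin.
  elim/(@cone_ind R A B f) => [z /Uin//|z s zp s0 s1].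
  move=> /Upt-/(_ (ltW s0) (ltW s1))[/= Nz [ds sd]] /Vpt-/(_ (ltW s0) (ltW s1)) /= [[N'z|]|].
  - exact: NN' Nz N'z.
  - by lra.
  - by lra.
have flip p q : (exists U V : set C, [/\ open U, open V, U p, V q
      & forall z, U z -> V z -> False]) ->
    exists U V : set C, [/\ open U, open V, U q, V p & forall z, U z -> V z -> False].
  by move=> [U [V [oU oV Up Vq UV]]]; exists V, U; split => // z Vz Uz; exact: UV Vz.
elim/(@cone_ind R A B f) => [y|x r xp r0 r1]; elim/(@cone_ind R A B f) => [y'|x' r' xp' r0' r1'].
- move=> yy'; have {}yy' : y <> y' by move=> h; apply: yy'; rewrite h.
  have [U [V [oU oV Uy Vy' UV]]] := hausdorff_sep hB yy'.
  have ofar (W : set B) : open W -> open [set p : A * R | W (f p.1)].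
    by move=> oW; apply: (oF (f @^-1` W)); exact: (iffLR (continuousP _) cf).
  have farP (W : set B) : open W -> ~ W point -> exists S : set C, [/\ open S,
      forall y, S (cin y) <-> W y & forall x r, 0 <= r -> r <= 1 ->
      S (cpt (x, r)) -> W (f x) /\ 2^-1 < r].
    move=> oW Wp; have [||||S [oS Sin Spt]] := @cone_open_set W
        ([set p | W (f p.1)] `&` [set p | 2^-1 < p.2]) oW.
    + by apply: openI; [exact: ofar|apply: (oT [set s | 2^-1 < s]); exact: open_gt].
    + by move=> z; split => [[]//|Wz]; split => //=; lra.
    + by move=> z; split => [[_ /=]|//]; lra.
    + by move=> s _ _; rewrite /= fp; split => // -[].
    exists S; split => // z s s0 s1 /Spt; exact.
  have nearP (W : set B) : open W -> W point -> exists S : set C, [/\ open S,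
      forall y, S (cin y) <-> W y & forall x r, 0 <= r -> r <= 1 ->
      S (cpt (x, r)) -> W (f x) \/ r < 2^-1].
    move=> oW Wp; have [||||S [oS Sin Spt]] := @cone_open_set W
        ([set p | W (f p.1)] `|` [set p | p.2 < 2^-1]) oW.
    + by apply: openU; [exact: ofar|apply: (oT [set s | s < 2^-1]); exact: open_lt].
    + by move=> z; split => [[//|/=]|Wz]; [lra|left].
    + by move=> z; split => // _; right => /=; lra.
    + by move=> s _ _; split => // _; left; rewrite /= fp.
    exists S; split => // z s s0 s1 /Spt; exact.
  have fin (P Q : set B) : open P -> open Q -> (forall z, P z -> Q z -> False) ->
      ~ Q point -> exists S S' : set C, [/\ open S, open S', forall y, S (cin y) <-> P y,
        forall y, S' (cin y) <-> Q y & forall z, S z -> S' z -> False].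
    move=> oP oQ PQ Qp; have [S' [oS' S'in S'pt]] := farP _ oQ Qp.
    have [Pp|Pp] := pselect (P point).
      have [S [oS Sin Spt]] := nearP _ oP Pp; exists S, S'; split => //.
      elim/(@cone_ind R A B f) => [z /Sin Pz /S'in|z s zp s0 s1]; first exact: PQ.
      move=> /(Spt _ _ (ltW s0) (ltW s1))[Pz|s2] /(S'pt _ _ (ltW s0) (ltW s1))[Qz s3].
        exact: PQ Qz.
      by have := lt_trans s2 s3; rewrite ltxx.
    have [S [oS Sin Spt]] := farP _ oP Pp; exists S, S'; split => //.
    elim/(@cone_ind R A B f) => [z /Sin Pz /S'in|z s zp s0 s1]; first exact: PQ.
    move=> /(Spt _ _ (ltW s0) (ltW s1))[Pz _] /(S'pt _ _ (ltW s0) (ltW s1))[Qz _].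
    exact: PQ Qz.
  have [Vp|Vp] := pselect (V point).
    have [|Up|S [S' [oS oS' Sin S'in SS']]] := fin V U oV oU.
    + by move=> z Vz Uz; exact: UV Vz.
    + exact: UV Up Vp.
    by apply: flip; exists S, S'; split => //; [apply/Sin|apply/S'in].
  have [S [S' [oS oS' Sin S'in SS']]] := fin U V oU oV UV Vp.
  by exists S, S'; split => //; [apply/Sin|apply/S'in].
- by move=> _; apply: flip; exact: inpt.
- by move=> _; exact: inpt.
move=> pq.
have fin (U U' : set A) (V V' : set R) : open U -> open U' -> open V -> open V' ->
    U x -> U' x' -> V r -> V' r' ->
    (forall z s, U z -> U' z -> V s -> V' s -> False) ->
    exists S S' : set C, [/\ open S, open S', S (cpt (x, r)), S' (cpt (x', r')) &
      forall z, S z -> S' z -> False].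
  move=> oU oU' oV oV' Ux U'x' Vr V'r' disj.
  have inner (W : set A) (I : set R) : open W -> open I -> exists S : set C, [/\ open S,
      forall y, ~ S (cin y) & forall z s, z <> point -> 0 < s -> s < 1 ->
        S (cpt (z, s)) <-> W z /\ I s].
    move=> oW oI; have [||||S [oS Sin Spt]] := @cone_open_set set0
        ((W `&` ~` [set point]) `*` (I `&` [set s | 0 < s /\ s < 1])) open0.
    + by apply: openX; apply: openI => //; exact: open_between.
    + by move=> z; split => // -[_ /= [_ []]]; lra.
    + by move=> z; split => // -[_ /= [_ []]]; lra.
    + by move=> s _ _; split => // -[/= []].
    exists S; split => // [y /Sin//|z s zp s0 s1]; rewrite Spt ?ltW //.
    by split => [[[? _] []]|[]] //.
  have [S [oS Sin Spt]] := inner U V oU oV.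
  have [S' [oS' S'in S'pt]] := inner U' V' oU' oV'.
  exists S, S'; split => //; [by apply/Spt|by apply/S'pt|].
  elim/(@cone_ind R A B f) => [y /Sin//|z s zp s0 s1].
  by move=> /Spt-/(_ zp s0 s1)[Uz Vs] /S'pt-/(_ zp s0 s1)[U'z V's]; exact: disj Uz U'z Vs V's.
have [xx'|xx'] := pselect (x = x'); last first.
  have [U [U' [oU oU' Ux U'x' UU']]] := hausdorff_sep hA xx'.
  apply: (fin U U' setT setT) => //; try exact: openT.
  by move=> z s Uz U'z _ _; exact: UU' Uz U'z.
have rr' : r <> r' by move=> rr'; apply: pq; rewrite xx' rr'.
have [V [V' [oV oV' Vr V'r' VV']]] := hausdorff_sep (@Rhausdorff R) rr'.
apply: (fin setT setT V V') => //; try exact: openT.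
by move=> z s _ _ Vs V's; exact: VV' Vs V's.
Qed.

End cone_topology.

Section cylinder.
Context {R : realType} {K : ptopologicalType} {C : nat -> Type}.
Context {phi : forall n, C n -> 'rV[R]_n -> K} (cw : cw_structure phi).

(** The product of a CW complex with the real line has the weak topology
    determined by the products of the closed cells with the line: a tube
    argument over compact intervals. *)
Lemma cw_cylinder_closedP (Z : set (K * R)) :
    (forall e : @cell C, closed [set p : 'rV[R]_(dim e) * R | Z (chi phi e p.1, p.2)]) ->
  closed Z.
Proof.
move=> clZ; rewrite -openC openE => -[y r] /= nZ.
have clP e (D : set R) : compact D ->
    closed (chi phi e @^-1` [set x | exists2 s, D s & Z (x, s)]).
  by move=> cD; exact: (closed_projection cD (clZ e)).
have [d d0 dP] : exists2 d, 0 < d & forall s, `|r - s| <= d -> ~ Z (y, s).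
  have := clZ (cell_of cw y); rewrite -openC openE => /(_ (coord cw y, r)).
  rewrite /= coordK => /(_ nZ) [[P Q] [/= nP nQ] PQ].
  have /nbhs_ballP [d /= d0 dQ] := nQ.
  exists (d / 2); first by rewrite divr_gt0.
  move=> s rs; have := PQ (coord cw y, s); rewrite /= coordK; apply; split => /=.
    exact: nbhs_singleton nP.
  by apply: dQ; rewrite -ball_normE /=; lra.
pose D : set R := `[r - d, r + d]%classic.
have DE s : D s <-> `|r - s| <= d.
  by rewrite /D /= in_itv /= ler_distlC; split => [/andP[h1 h2]|/andP[h1 h2]]; apply/andP; split; lra.
exists (~` [set x | exists2 s, D s & Z (x, s)], D).
  split => /=; last first.
    apply/nbhs_ballP; exists d => //= s; rewrite -ball_normE /= => h.
    by apply/DE; exact: ltW.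
  apply: open_nbhs_nbhs; split.
    apply: closed_openC; apply: (cw_closedP cw) => e.
    by apply: (clP e D); exact: segment_compact.
  by move=> [s /DE /dP].
by move=> [x s] /= [nx Ds] Zs; apply: nx; exists s.
Qed.

End cylinder.

Section cone_cw.
Context {R : realType} {K M : ptopologicalType} {CK CM : nat -> Type}.
Context {phiK : forall n, CK n -> 'rV[R]_n -> K} (cwK : cw_structure phiK).
Context {phiM : forall n, CM n -> 'rV[R]_n -> M} (cwM : cw_structure phiM).
Variables (c0 : CK 0%N) (m0 : CM 0%N).
Hypotheses (c0p : forall v, phiK c0 v = point) (m0p : forall v, phiM m0 v = point).
Variable g : K -> M.
Hypothesis bg : based_map g.
Hypothesis cellular : forall e : @cell CK, exists s : seq (@cell CM),
  (forall e', e' \in s -> (dim e' <= dim e)%N) /\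
  forall v, cell_of cwM (g (chi phiK e v)) \in s.
Local Notation cone := (mapping_cone R g).
Local Notation e0 := (existT CK 0%N c0).
Local Notation d0 := (existT CM 0%N m0).

(** The product of an [n]-cell with the interval has dimension [n + 1]; over the base
    vertex it is collapsed to the base point. *)
Definition cylinder_cells (n : nat) : Type :=
  if n is n'.+1 then {c : CK n' | existT CK n' c <> e0} else Empty_set.

Definition cone_cells (n : nat) : Type := (CM n + cylinder_cells n)%type.

(** A cell of the cylinder is parametrized by the product of an interval and of a
    cube; the first coordinate is rescaled from [-1, 1] to [0, 1]. *)
Definition height n (v : 'rV[R]_n.+1) : R := (lsubmx (v : 'rV[R]_(1 + n)) 0 0 + 1) / 2.
Definition side n (v : 'rV[R]_n.+1) : 'rV[R]_n := rsubmx (v : 'rV[R]_(1 + n)).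
Definition cyl n (w : 'rV[R]_n) (r : R) : 'rV[R]_n.+1 :=
  row_mx (\row_(i < 1) (2 * r - 1)) w.

Definition cone_phi (n : nat) : cone_cells n -> 'rV[R]_n -> cone :=
  match n with
  | 0%N => fun c v => match c with inl m => cone_in R g (phiM m v)
                                 | inr d => match d with end end
  | n'.+1 => fun c v => match c with inl m => cone_in R g (phiM m v)
      | inr d => cone_pt g (phiK (sval d) (side v), height v) end
  end.

Definition base_cell (e : {n & CM n}) : {n & cone_cells n} :=
  existT cone_cells (projT1 e) (inl (projT2 e)).

Definition cyl_cell (e : {n & CK n}) : e <> e0 -> {n & cone_cells n} :=
  match e with existT n c => fun ne => existT cone_cells n.+1 (inr (exist _ c ne)) end.

Lemma cyl_cell_eq e e' ne ne' : e = e' -> @cyl_cell e ne = @cyl_cell e' ne'.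
Proof. by move=> ee'; subst e'; rewrite (Prop_irrelevance ne ne'). Qed.

Lemma dim_cyl_cell e ne : projT1 (@cyl_cell e ne) = (projT1 e).+1.
Proof. by case: e ne. Qed.

Lemma cone_cell_ind (P : {n & cone_cells n} -> Prop) :
  (forall e, P (base_cell e)) -> (forall e ne, P (@cyl_cell e ne)) -> forall e, P e.
Proof.
move=> Pb Pc [[|n] [c|]]; [exact: (Pb (existT CM 0%N c))|by []|exact: (Pb (existT CM n.+1 c))|].
by move=> [c ne]; exact: (Pc (existT CK n c) ne).
Qed.

Local Notation cphi e := (@cone_phi (projT1 e) (projT2 e)).

Lemma cphi_base (e : {n & CM n}) v : cphi (base_cell e) v = cone_in R g (phiM (projT2 e) v).
Proof. by case: e v => -[]. Qed.

Lemma sideK n (w : 'rV[R]_n) r : side (cyl w r) = w.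
Proof. by rewrite /side /cyl row_mxKr. Qed.
Lemma heightK n (w : 'rV[R]_n) r : height (cyl w r) = r.
Proof. by rewrite /height /cyl row_mxKl mxE; field. Qed.
Lemma cylK n (v : 'rV[R]_n.+1) : cyl (side v) (height v) = v.
Proof.
transitivity (row_mx (lsubmx (v : 'rV[R]_(1 + n))) (side v)); last first.
  exact: (@hsubmxK _ 1 1 n).
rewrite /cyl (_ : \row_i _ = lsubmx (v : 'rV[R]_(1 + n))) //.
by apply/rowP => i; rewrite mxE /height (ord1 i); field.
Qed.

Lemma continuous_side n : continuous (@side n).
Proof.
apply: cont_row => i; rewrite (_ : (fun v => _) = fun v : 'rV[R]_n.+1 =>
  v 0 (rshift 1 i : 'I_(1 + n))); first exact: coord_continuous.
by apply/funext => v; rewrite /side mxE.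
Qed.

Lemma continuous_height n : continuous (@height n).
Proof.
apply: cont_mul; last by cont.
apply: cont_add; last by cont.
rewrite (_ : (fun v => _) = fun v : 'rV[R]_n.+1 =>
  v 0 (lshift n 0 : 'I_(1 + n))); first exact: coord_continuous.
by apply/funext => v; rewrite mxE.
Qed.

Lemma continuous_cyl n (T : topologicalType) (w : T -> 'rV[R]_n) (r : T -> R) :
  continuous w -> continuous r -> continuous (fun x => cyl (w x) (r x)).
Proof.
move=> cw cr; apply: cont_row => i.
rewrite (_ : (fun x => _) = fun x => if fintype.split (i : 'I_(1 + n)) is inr k then w x 0 k
  else 2 * r x - 1).
  case: (fintype.split _) => k; first by cont.
  by apply: (@cont_comp _ _ _ (fun u : 'rV[R]_n => u 0 k)) => //; exact: coord_continuous.
apply/funext => x; rewrite /cyl mxE; case: (fintype.split _) => k //; by rewrite mxE.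
Qed.

Lemma cyl_coord (P : R -> Prop) n (w : 'rV[R]_n) r :
  (forall i, P (cyl w r 0 i)) <-> (forall i, P (w 0 i)) /\ P (2 * r - 1).
Proof.
split => [h|[hw hr] i].
  split => [i|].
    by have := h (rshift 1 i : 'I_(1 + n)); rewrite /cyl (@row_mxEr _ 1 1 n).
  by have := h (lshift n ord0 : 'I_(1 + n)); rewrite /cyl (@row_mxEl _ 1 1 n) mxE.
rewrite /cyl mxE; case: (fintype.split _) => k; [by rewrite mxE|exact: hw].
Qed.

Lemma norm_cyl_le n (w : 'rV[R]_n) r : `|cyl w r| <= 1 <-> `|w| <= 1 /\ 0 <= r <= 1.
Proof.
rewrite !norm_row_le // (cyl_coord (fun x => `|x| <= 1)) ler_norml.
by split => -[h /andP[h1 h2]]; split => //; apply/andP; split; lra.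
Qed.

Lemma norm_cyl_lt n (w : 'rV[R]_n) r : `|cyl w r| < 1 <-> `|w| < 1 /\ 0 < r < 1.
Proof.
rewrite !norm_row_lt // (cyl_coord (fun x => `|x| < 1)) ltr_norml.
by split => -[h /andP[h1 h2]]; split => //; apply/andP; split; lra.
Qed.

Lemma cphi_cyl e ne w r :
  exists v : 'rV[R]_(projT1 (@cyl_cell e ne)), 
    [/\ cphi (@cyl_cell e ne) v = cone_pt g (phiK (projT2 e) w, r),
      `|v| <= 1 <-> `|w| <= 1 /\ 0 <= r <= 1 & `|v| < 1 <-> `|w| < 1 /\ 0 < r < 1].
Proof.
case: e ne w => n c ne w /=; exists (cyl w r); rewrite sideK heightK.
by split => //; [exact: norm_cyl_le|exact: norm_cyl_lt].
Qed.

Lemma cphi_cyl_inv e ne (v : 'rV[R]_(projT1 (@cyl_cell e ne))) :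
  exists w r, [/\ cphi (@cyl_cell e ne) v = cone_pt g (phiK (projT2 e) w, r),
      `|v| <= 1 <-> `|w| <= 1 /\ 0 <= r <= 1 & `|v| < 1 <-> `|w| < 1 /\ 0 < r < 1].
Proof.
case: e ne v => n c ne /= v; exists (side v), (height v); split => //.
  by rewrite -{1}[v]cylK; exact: norm_cyl_le.
by rewrite -{1}[v]cylK; exact: norm_cyl_lt.
Qed.

Let cell_of_point : cell_of cwK point = e0.
Proof.
rewrite -(c0p 0) -(@chi_phi _ _ _ phiK e0) ?normr0 //.
by rewrite cell_of_chi ?normr0.
Qed.

Let cell_of_e0 x : cell_of cwK x = e0 -> x = point.
Proof.
move=> xe; rewrite -(coordK cwK x); move: (coord cwK x); rewrite xe => v.
exact: c0p.
Qed.

Let phi_chiK (e : {n & CK n}) w : `|w| <= 1 -> phiK (projT2 e) w = chi phiK e w.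
Proof. by move=> w1; rewrite chi_phi. Qed.

Let phi_chiM (e : {n & CM n}) w : `|w| <= 1 -> phiM (projT2 e) w = chi phiM e w.
Proof. by move=> w1; rewrite chi_phi. Qed.

Let chi_neq_point (e : {n & CK n}) w : e <> e0 -> `|w| < 1 -> phiK (projT2 e) w <> point.
Proof.
move=> ne w1 h; apply: ne; rewrite -cell_of_point -h phi_chiK ?ltW //.
by rewrite cell_of_chi.
Qed.

Lemma within_cube (n : nat) (T : topologicalType) (F G : 'rV[R]_n -> T) :
  continuous G -> (forall v, `|v| <= 1 -> F v = G v) ->
  {within cube R n, continuous F}.
Proof.
move=> cG FG; apply: (@subspace_eq_continuous _ _ _ G); last exact: continuous_subspaceT.
by move=> v /set_mem /cubeE v1; rewrite /from_subspace FG.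
Qed.

Lemma cone_phi_continuous n (c : cone_cells n) : {within cube R n, continuous (cone_phi c)}.
Proof.
have cin := @continuous_cone_in R _ _ g; have cpt := @continuous_cone_pt R _ _ g.
have base m : {within cube R n, continuous (fun v => cone_in R g (phiM (n := n) m v))}.
  have cc := continuous_chi cwM (e := existT CM n m).
  apply: (within_cube (G := fun v => cone_in R g (chi phiM (existT CM n m) v))).
    exact: (cont_comp cin cc).
  by move=> v v1; rewrite -phi_chiM.
case: n c base => [|n] [m|d] base; [exact: (base m)|by []|exact: (base m)|].
case: d => c ne /=; pose e : cell := existT CK n c.
have cc := continuous_chi cwK (e := e).
apply: (within_cube (G := fun v => cone_pt g (chi phiK e (side v), height v))).
  apply: (cont_comp cpt); apply: cont_pair; last exact: continuous_height.
  exact: (cont_comp cc (@continuous_side n)).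
move=> v; rewrite -[v]cylK => /norm_cyl_le [w1 _].
by rewrite sideK heightK -phi_chiK.
Qed.

Lemma cone_phi_injective n (c : cone_cells n) : {in open_cube R n &, injective (cone_phi c)}.
Proof.
have injM m : {in open_cube R n &, injective (fun v => cone_in R g (phiM (n := n) m v))}.
  move=> v v' v1 v'1 /cone_in_inj; have [_ inj _ _ _] := cwM.
  by have [_] := inj n m; apply.
case: n c injM => [|n] [m|d] injM; [exact: (injM m)|by []|exact: (injM m)|].
case: d => c ne v v' /set_mem /open_cubeE + /set_mem /open_cubeE.
rewrite -[v]cylK -[v']cylK => /norm_cyl_lt [w1 /andP[r0 r1]] /norm_cyl_lt [w1' /andP[r0' r1']].
rewrite /= !sideK !heightK => h.
have nz w : `|w| < 1 -> phiK c w <> point by exact: (@chi_neq_point (existT CK n c)).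
have [pw ->] := cone_pt_inj (nz _ w1) (nz _ w1') r0 r1 r0' r1' h.
congr cyl; have [_ inj _ _ _] := cwK; have [_ injc] := inj n c.
by apply: injc => //; apply/mem_set/open_cubeE.
Qed.

Lemma cone_phi_partition (y : cone) :
  exists! e : {n & cone_cells n}, (cphi e @` open_cube R (projT1 e)) y.
Proof.
elim/(@cone_ind R K M g): y => [y|x r xp r0 r1].
  exists (base_cell (cell_of cwM y)); split.
    exists (coord cwM y); first exact/open_cubeE/norm_coord.
    by rewrite cphi_base phi_chiM ?coordK // ltW // norm_coord.
  elim/cone_cell_ind => [e|e ne] [v /open_cubeE v1].
    rewrite cphi_base => /cone_in_inj; rewrite phi_chiM ?(ltW v1) // => <-.
    by rewrite cell_of_chi.
  have [w [r [-> _ v1E]]] := cphi_cyl_inv v.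
  have [w1 /andP[r0 r1]] := iffLR v1E v1.
  by move=> /cone_pt_neq_in; case => //; exact: chi_neq_point.
have ne : cell_of cwK x <> e0 by move=> /cell_of_e0.
exists (cyl_cell ne); split.
  have [v [vE _ v1]] := cphi_cyl ne (coord cwK x) r.
  exists v; first by apply/open_cubeE/v1; split; [exact: norm_coord|rewrite r0 r1].
  by rewrite vE phi_chiK ?coordK // ltW // norm_coord.
elim/cone_cell_ind => [e|e ne'] [v /open_cubeE v1].
  by rewrite cphi_base => /esym/cone_pt_neq_in; case.
have [w [r' [-> _ v1E]]] := cphi_cyl_inv v.
have [w1 /andP[r0' r1']] := iffLR v1E v1.
move=> /cone_pt_inj -/(_ (chi_neq_point ne' w1) xp r0' r1' r0 r1) [wx _].
by apply: cyl_cell_eq; rewrite -wx phi_chiK ?(ltW w1) // cell_of_chi.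
Qed.

(** The boundary of the cell over [e] consists of the cone point, of the image of [e]
    in the base, where [cellular] bounds the dimensions, and of the cylinder over
    the boundary of [e]. *)
Lemma cone_phi_boundary n (c : cone_cells n) : exists E : set {m & cone_cells m},
  [/\ finite_set E, (forall e, E e -> (projT1 e < n)%N) &
    cone_phi c @` (cube R n `\` open_cube R n)
      `<=` \bigcup_(e in E) (cphi e @` open_cube R (projT1 e))].
Proof.
have inbase y : (cphi (base_cell (cell_of cwM y)) @`
    open_cube R (projT1 (base_cell (cell_of cwM y)))) (cone_in R g y).
  exists (coord cwM y); first exact/open_cubeE/norm_coord.
  by rewrite cphi_base phi_chiM ?coordK // ltW // norm_coord.
suff bd (e : {m & cone_cells m}) : exists E : set {m & cone_cells m},
    [/\ finite_set E, (forall e', E e' -> (projT1 e' < projT1 e)%N) &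
      forall v, `|v| = 1 -> exists2 e', E e' &
        (cphi e' @` open_cube R (projT1 e')) (cphi e v)].
  have [E [finE dE bE]] := bd (existT _ n c); exists E; split => //.
  move=> _ [v [/cubeE v1 /open_cubeE nv1] <-].
  have [|e' Ee' ve'] := bE v; last by exists e'.
  by apply/eqP; rewrite eq_le v1 leNgt; apply/negP.
elim/cone_cell_ind: e => [e|e ne].
  exists [set base_cell e' | e' in [set` bnd cwM e]]; split.
  - by apply: finite_image; exact: finite_seq.
  - by move=> _ [e' /dim_bnd e'e <-].
  - move=> v v1; rewrite cphi_base phi_chiM ?v1 //.
    exists (base_cell (cell_of cwM (chi phiM e v))) => //.
    by exists (cell_of cwM (chi phiM e v)) => //; exact: mem_bnd.
have [s [se sg]] := cellular e.
pose cyl' (e' : {m & CK m}) := if pselect (e' <> e0) is left ne' then cyl_cell ne'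
  else base_cell d0.
exists ([set base_cell e' | e' in [set` (d0 : @cell CM) :: s]] `|` [set cyl' e' | e' in [set` bnd cwK e]]).
split.
- by rewrite finite_setU; split; apply: finite_image; exact: finite_seq.
- rewrite dim_cyl_cell => _ [[e' /= e's <-]|[e' /dim_bnd e'e <-]].
    rewrite ltnS; move: e's; rewrite inE => /predU1P[->//|]; exact: se.
  by rewrite /cyl'; case: pselect => // ne'; rewrite dim_cyl_cell ltnS.
have inpoint : (cphi (base_cell d0) @` open_cube R (projT1 (base_cell d0))) point.
  exists 0; first by apply/open_cubeE; rewrite normr0.
  by rewrite cphi_base /= m0p.
move=> v v1; have [w [r [-> v1E v1E']]] := cphi_cyl_inv v.
have [|w1 /andP[r0 r1]] := iffLR v1E; first by rewrite v1.
rewrite phi_chiK //; set x := chi phiK e w.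
have [r00|r00] := leP r 0.
  exists (base_cell d0); last by rewrite cone_pt0.
  by left; exists d0 => //=; rewrite mem_head.
have [r11|r11] := leP 1 r.
  rewrite cone_pt1 //; exists (base_cell (cell_of cwM (g x))) => //.
  by left; exists (cell_of cwM (g x)) => //=; rewrite inE sg orbT.
have w1' : `|w| = 1.
  apply/eqP; rewrite eq_le w1 leNgt; apply/negP => w1'.
  by have := iffRL v1E'; rewrite v1 ltxx => h; suff : false by []; apply: h; rewrite r00 r11.
have [xe|xe] := pselect (cell_of cwK x = e0).
  rewrite (cell_of_e0 xe) cone_ptb; last by case: bg.
  by exists (base_cell d0) => //; left; exists d0 => //=; rewrite mem_head.
exists (cyl_cell xe).
  right; exists (cell_of cwK x); first exact: mem_bnd.
  by rewrite /cyl'; case: pselect => // ne'; exact: cyl_cell_eq.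
have [v' [v'E _ v'1]] := cphi_cyl xe (coord cwK x) r.
exists v'; first by apply/open_cubeE/v'1; split; [exact: norm_coord|rewrite r00 r11].
by rewrite v'E phi_chiK ?coordK // ltW // norm_coord.
Qed.

Lemma cone_phi_weak (A : set cone) :
  (forall n (c : cone_cells n), closed (cube R n `&` cone_phi c @^-1` A)) -> closed A.
Proof.
move=> clA; apply: cone_closedP.
  apply: (cw_closedP cwM) => e.
  have := clA _ (projT2 (base_cell e)).
  have cr : continuous (@retr R (dim e)) by apply: cont_retr; exact: cont_id.
  move=> /(iffLR (continuous_closedP _) cr _); congr closed.
  apply/seteqP; split => v /=; rewrite cphi_base phi_chiM ?norm_retr_le ?chi_retr //.
    by case.
  by move=> Av; split => //; apply/cubeE; exact: norm_retr_le.
apply: (cw_cylinder_closedP cwK) => e.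
have [ee0|ne] := pselect ((e : {n & CK n}) = e0).
  have chip v : chi phiK e v = point by move: v; rewrite ee0 => v; exact: c0p.
  have cpt0 (r : R) : cone_pt g (point, r) = point by rewrite cone_ptb //; case: bg.
  have [Ap|Ap] := pselect (A point).
    rewrite (_ : [set p | _] = setT); first exact: closedT.
    by apply/seteqP; split => -[v r] //= _; rewrite chip cpt0.
  rewrite (_ : [set p | _] = set0); first exact: closed0.
  by apply/seteqP; split => -[v r] //=; rewrite chip cpt0.
have : closed ((fun p : 'rV[R]_(dim e) * R => cyl (retr p.1) (clamp p.2)) @^-1`
    (cube R (dim e).+1 `&` (fun v => cone_pt g (phiK (projT2 e) (side v), height v)) @^-1` A)).
  apply: (iffLR (continuous_closedP _)).
    by apply: continuous_cyl; [apply: cont_retr; cont|cont].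
  by case: e ne => n c ne; exact: (clA n.+1 (inr (exist _ c ne))).
congr closed; apply/seteqP; split => -[v r] /=;
  rewrite sideK heightK phi_chiK ?norm_retr_le // chi_retr cone_pt_clamp; first by case.
move=> Av; split => //; apply/cubeE/norm_cyl_le.
by split; [exact: norm_retr_le|rewrite clamp_ge0 clamp_le1].
Qed.

Theorem cw_structure_cone : cw_structure cone_phi.
Proof.
split.
- by apply: cone_hausdorff => //; [exact: cw_hausdorff cwK|exact: cw_hausdorff cwM].
- by move=> n c; split; [exact: cone_phi_continuous|exact: cone_phi_injective].
- exact: cone_phi_partition.
- exact: cone_phi_boundary.
- exact: cone_phi_weak.
Qed.

Lemma based_cw_complex_cone : based_cw_complex R cone.
Proof.
exists cone_cells, cone_phi; split; first exact: cw_structure_cone.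
by exists (inl m0) => v; rewrite /= m0p.
Qed.

End cone_cw.

Section cw_spaces.
Context {R : realType}.
Implicit Types A B K M : ptopologicalType.

Lemma cell_of_vertex K (C : nat -> Type) (phi : forall n, C n -> 'rV[R]_n -> K)
    (cw : cw_structure phi) (c : C 0%N) :
  (forall v, phi 0%N c v = point) -> dim (cell_of cw point) = 0%N.
Proof.
move=> cp; rewrite -(cp 0) -(@chi_phi _ _ _ phi (existT C 0%N c)) ?normr0 //.
by rewrite cell_of_chi ?normr0.
Qed.

Lemma connected_cone A B (f : A -> B) : connected [set: B] ->
  connected [set: mapping_cone R f].
Proof.
move=> cB; pose S (i : option A) : set (mapping_cone R f) :=
  if i is Some x then range (fun r : R => cone_pt f (x, r)) else range (cone_in R f).
rewrite (_ : [set: _] = \bigcup_(i in setT) S i); last first.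
  apply/seteqP; split => // z _; elim/(@cone_ind R A B f): z => [y|x r _ _ _].
    by exists None => //; exists y.
  by exists (Some x) => //; exists r.
apply: bigcup_connected.
  exists point => -[x|] _; last by exists point.
  by exists 0 => //; rewrite cone_pt0.
have cin := @continuous_cone_in R _ _ f; have cpt := @continuous_cone_pt R _ _ f.
case=> [x|] _; apply: connected_continuous_connected.
- by apply/connected_intervalP.
- apply: continuous_subspaceT; apply: (cont_comp cpt).
  by apply: (@cont_pair R A R (fun=> x) id); [exact: cont_cst|exact: cont_id].
- exact: cB.
- exact: continuous_subspaceT.
Qed.

Lemma cone_based_cw_complex K M (f : K -> M) : based_map f ->
    based_cw_complex R K -> based_cw_complex R M ->
  exists2 N, based_cw_complex R N & same_htype R (mapping_cone R f) N.
Proof.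
move=> [cf fp] [CK [phiK [cwK [c0 c0p]]]] [CM [phiM [cwM [m0 m0p]]]].
have [H [cH H0 Hcell Hfix]] := cellular_approximation cwK cwM cf.
have Hp t : H (point, t) = point.
  by rewrite Hfix ?fp //; [exact: cell_of_vertex c0p|exact: cell_of_vertex m0p].
pose g y := H (y, 1).
have bg : based_map g by split; [rewrite /g; cont|exact: Hp].
exists (mapping_cone R g); first by apply: (@based_cw_complex_cone _ _ _ _ _ _ cwK _ cwM c0 m0 c0p m0p g bg) => e; exact: Hcell.
apply: same_htype_sym; apply: same_htype_cone_homotopic => //.
by apply: (homotopic_by cH).
Qed.

(** By homotopy invariance [f] may be transported to a map between CW complexes, and
    then made cellular. *)
Lemma cw_space_cone A B (f : A -> B) : based_map f -> cw_space R A -> cw_space R B ->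
  cw_space R (mapping_cone R f).
Proof.
move=> bf [_ [K cK [a ha]]] [cB [M cM [b hb]]]; split; first exact: connected_cone.
have [a' [ha' _ _]] := heq_inv ha; have [ba' _] := ha'; have [bb _] := hb.
have bfa := based_map_comp ba' bf.
have [N cN fN] := cone_based_cw_complex (based_map_comp bfa bb) cK cM.
exists N => //; apply: same_htype_trans fN.
apply: same_htype_trans (same_htype_cone_target bfa hb).
exact: same_htype_sym (same_htype_cone_source bf ha').
Qed.

End cw_spaces.

(** * Subadditivity of killing length *)

Section killing_length.
Context {R : realType} (F : ptopologicalType -> Prop).
Implicit Types X Y Z : ptopologicalType.

Lemma cofiber_of_cone X Y Z (f : X -> Y) : based_map f ->
    same_htype R (mapping_cone R f) Z ->
  exists g : Y -> Z, cofiber_sequence R f g.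
Proof.
move=> bf [h hh]; have [bh _] := hh.
have bin : based_map (cone_in R f) by split => //; exact: continuous_cone_in.
have bhin := based_map_comp bin bh.
by exists (h \o cone_in R f); split => //; exists h; split => //; exact: homotopic_refl.
Qed.

Lemma cone_of_cofiber X Y Z (f : X -> Y) (g : Y -> Z) : cofiber_sequence R f g ->
  based_map f /\ same_htype R (mapping_cone R f) Z.
Proof. by move=> [bf _ [h [hh _]]]; split => //; exists h. Qed.

Lemma killing_decomposition_htype X Y m : same_htype R X Y ->
  killing_decomposition R F X m -> killing_decomposition R F Y m.
Proof.
move=> XY [Xs [cw X0 Xm step]]; exists Xs; split => //.
exact: same_htype_trans XY.
Qed.

(** Induction on the length [m] of the decomposition of [X]: the first step coned off
    [L], and [Y1] is obtained from [Y] by coning off [L] as well.  When [m = 0] the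
    space [X] is contractible and [Y] is equivalent to [Z]. *)
Lemma killing_decomposition_cofiber X Y Z (f : X -> Y) m n :
    cw_space R Y -> based_map f -> same_htype R (mapping_cone R f) Z ->
    killing_decomposition R F X m -> killing_decomposition R F Z n ->
  killing_decomposition R F Y (m + n).
Proof.
move=> + + + + dZ; elim: m X Y f => [|m IH] X Y f cwY bf fZ [Xs [cw X0 Xm step]].
  apply: killing_decomposition_htype dZ; apply/same_htype_sym.
  apply: same_htype_trans fZ; apply: same_htype_cone_contractible => //.
  by apply: same_htype_trans Xm; exact: same_htype_sym.
have [J [S [FS cwS [l [g lg]]]]] := step 0%N isT.
have [bl [h hh]] := cone_of_cofiber lg.
have [e he] := X0; have [be _] := he.
pose b := f \o e; have bb : based_map b by exact: based_map_comp.
have bbl := based_map_comp bl bb.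
pose Y1 := mapping_cone R (b \o l).
have [h' [hh' _ _]] := heq_inv hh; have [bh' _] := hh'.
have cwY1 : cw_space R Y1 by exact: cw_space_cone.
have bc : based_map (@cone_post R _ _ _ b l) by exact: based_cone_post.
have [|||Ys [cwYs Ys0 Ysm Ystep]] :=
    IH (Xs 1%N) Y1 (@cone_post R _ _ _ b l \o h') cwY1.
- exact: based_map_comp.
- apply: same_htype_trans (same_htype_cone_source bc hh') _.
  apply: same_htype_trans (same_htype_sym (same_htype_cone_composite bl bb)) _.
  exact: same_htype_trans (same_htype_cone_source bf he) _.
- exists (fun i => Xs i.+1); split => //; first by move=> i im; exact: cw.
    exact: same_htype_refl.
  by move=> i im; exact: step.
exists (fun i => if i is i'.+1 then Ys i' else Y); split.
- by case=> [|i] //= im; exact: cwYs.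
- exact: same_htype_refl.
- by rewrite addSn.
- case=> [|i] /= im; last exact: Ystep.
  have [g' cg'] := cofiber_of_cone bbl (same_htype_sym Ys0).
  by exists J, S; split => //; exists (b \o l), g'.
Qed.

Lemma killing_length_ge0 X : (0 <= killing_length R F X)%E.
Proof.
rewrite /killing_length; case: (pselect (same_htype _ _ _)) => [?|?] //=.
by case: pselect => // ex; rewrite lee_fin ler0n.
Qed.

Lemma killing_lengthP X : cw_space R X -> killing_length R F X != +oo%E ->
  exists2 m, killing_decomposition R F X m & killing_length R F X = (m%:R%:E)%E.
Proof.
move=> cwX; rewrite /killing_length; case: (pselect (same_htype _ _ _)) => [X0 _|nX0] /=.
  by exists 0%N => //; exists (fun=> X); split => //; exact: same_htype_refl.
case: pselect => // ex _; case: ex_minnP => m /asboolP dm _; by exists m.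
Qed.

Lemma killing_length_le X m :
  killing_decomposition R F X m -> (killing_length R F X <= (m%:R)%:E)%E.
Proof.
move=> dm; rewrite /killing_length; case: (pselect (same_htype _ _ _)) => [?|?] /=; first by rewrite lee_fin.
case: pselect => [ex|[]]; last by exists m; apply/asboolP.
case: ex_minnP => k _ /(_ m (asboolT dm)) km; by rewrite lee_fin ler_nat.
Qed.

End killing_length.

Theorem theorem3p4 (R : realType) (F : ptopologicalType -> Prop)
    (F_spaces : forall S : ptopologicalType, F S -> cw_space R S)
    (X Y Z : ptopologicalType)
    (X_space : cw_space R X) (Y_space : cw_space R Y) (Z_space : cw_space R Z)
    (j : X -> Y) (q : Y -> Z) (jq : cofiber_sequence R j q) :
  (killing_length R F Y <= killing_length R F X + killing_length R F Z)%E.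
Proof.
have gX := killing_length_ge0 (R := R) F X; have gZ := killing_length_ge0 (R := R) F Z.
have [->|fX] := eqVneq (killing_length R F X) +oo%E.
  by rewrite addye ?leey //; apply: contraTneq gZ => ->.
have [->|fZ] := eqVneq (killing_length R F Z) +oo%E.
  by rewrite addey ?leey //; apply: contraTneq gX => ->.
have [m dm ->] := killing_lengthP X_space fX.
have [n dn ->] := killing_lengthP Z_space fZ.
have [bj jZ] := cone_of_cofiber jq.
rewrite -EFinD -natrD; apply: killing_length_le.
exact: killing_decomposition_cofiber jZ dm dn.
Qed.
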